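(* Let $c\ge0$, $M=\mathbb C^\times$ with coordinate $z^0$ and $\mathfrak F=\frac i2(z^0)^2$ (so that the associated projective special Kähler manifold is a point), let $m\in\mathbb Z\setminus\{0\}$, $\mathrm{Supp}(\Omega)=\{\pm\partial_{y_0}\}$, $\Omega(\pm\partial_{y_0})=m$, and let $(\overline N_+,g_{\overline N})$ be the associated positive definite quaternionic-Kähler metric constructed over $M_K=\{|z^0|>K\}$, $K>0$ sufficiently large (see context). Then $(\overline N_+,g_{\overline N})$ gives a deformation of the universal hypermultiplet $(\overline N_{\mathrm{UH}},g^c_{\mathrm{FS}})$ near its infinite end of finite volume; that is, there is a neighborhood of the end $\rho\to\infty$ of $\overline N_{\mathrm{UH}}$ (the infinite end of finite $g^c_{\mathrm{FS}}$-volume) contained in $\overline N_+$, on which both $g^c_{\mathrm{FS}}$ and $g_{\overline N}$ are defined and positive definite, $g^c_{\mathrm{FS}}$ being the metric obtained by putting $\Omega=0$ in the construction of $g_{\overline N}$.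
   Context: **Geometry of $M=\mathbb C^\times$.** $\tau_{00}=i$, $N_{00}=1$, $w_0=iz^0$, $x^0=\mathrm{Re}\,z^0$, $y_0=-\mathrm{Re}\,w_0$, $g_M=|dz^0|^2$, $\omega_M=\frac i2dz^0\wedge d\overline z^0=dx^0\wedge dy_0$, $\nabla=d$, $\xi=z^0\partial_{z^0}+\overline z^0\partial_{\overline z^0}$, $J$ the complex structure, $\Lambda=\mathrm{span}_{\mathbb Z}\{\partial_{x^0},\partial_{y_0}\}$ with pairing $\langle\cdot,\cdot\rangle=\omega_M|_{\Lambda\times\Lambda}$ and Darboux frame $(\widetilde\gamma_0,\gamma^0)=(\partial_{x^0},\partial_{y_0})$; central charge: $Z_{\partial_{y_0}}=z^0$, $Z_{\partial_{x^0}}=iz^0$. $r^2=|z^0|^2$, $\widetilde\eta=r^{-2}g_M(J\xi,\cdot)$. **Hyperkähler structure.** $N:=T^*M_K/\Lambda^*$, projection $\pi_M$; $\theta_\gamma([\alpha])=2\pi\alpha(\gamma)$ mod $2\pi$; $\langle dA\wedge dB\rangle:=dA_{\widetilde\gamma_0}\wedge dB_{\gamma^0}-dA_{\gamma^0}\wedge dB_{\widetilde\gamma_0}$; pullbacks omitted. With $K_0,K_1$ modified Bessel functions of the second kind, $$V_\gamma^{\mathrm{inst}}=\frac1{2\pi}\sum_{k>0}e^{ik\theta_\gamma}K_0(2\pi k|Z_\gamma|),\quad A_\gamma^{\mathrm{inst}}=-\frac1{4\pi}\sum_{k>0}e^{ik\theta_\gamma}|Z_\gamma|K_1(2\pi k|Z_\gamma|)\Big(\frac{dZ_\gamma}{Z_\gamma}-\frac{d\overline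 Z_\gamma}{\overline Z_\gamma}\Big),$$ $$\omega_1+i\omega_2=-\frac1{2\pi}\langle dZ\wedge d\theta\rangle+\sum_\gamma\Big(\Omega(\gamma)dZ_\gamma\wedge A_\gamma^{\mathrm{inst}}+\frac{i\Omega(\gamma)}{2\pi}V_\gamma^{\mathrm{inst}}d\theta_\gamma\wedge dZ_\gamma\Big),$$ $$\omega_3=\frac14\langle dZ\wedge d\overline Z\rangle-\frac1{8\pi^2}\langle d\theta\wedge d\theta\rangle+\sum_\gamma\Big(\frac{i\Omega(\gamma)}2V_\gamma^{\mathrm{inst}}dZ_\gamma\wedge d\overline Z_\gamma+\frac{\Omega(\gamma)}{2\pi}d\theta_\gamma\wedge A_\gamma^{\mathrm{inst}}\Big),$$ sums over $\gamma\in\{\pm\partial_{y_0}\}$. $K$ is taken so large that $T=\pi_M^*g_M+\sum_\gamma\Omega(\gamma)V_\gamma^{\mathrm{inst}}|dZ_\gamma|^2$ is non-degenerate on $TN/\ker d\pi_M$; then $\omega_\alpha=g_N(I_\alpha\cdot,\cdot)$ for a pseudo-hyperkähler structure $(g_N,I_1,I_2,I_3)$, $I_\alpha=-\omega_\beta^{-1}\circ\omega_\gamma$ (cyclic). $V$ is the horizontal lift of $J\xi$ to $N$ ($d\theta_\gamma(V)=0$), $X:=2V$. **Circle bundle and QK metric.** Identify $T^*M\cong\Lambda^*\otimes\mathbb R$ by $\alpha\mapsto\theta=2\pi\alpha|_\Lambda$. The groups $2\pi\Lambda^*\times\pi\mathbb Z$ (discrete Heisenberg groups $\mathrm{Heis}(\Lambda^*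 )$, product $(2\pi\delta,\pi k)\cdot(2\pi\delta',\pi k')=(2\pi(\delta+\delta'),\pi(k+k'+\langle\delta,\delta'\rangle))$) act fibrewise on $T^*M\times\mathbb R_\sigma$ by $(2\pi\delta,\pi k)\cdot(\theta,\sigma)=(\theta+2\pi\delta,\sigma+\pi k+\frac12\langle\delta,\theta\rangle)$, where $\langle\delta,\theta\rangle=\delta_{\widetilde\gamma_0}\theta_{\gamma^0}-\delta_{\gamma^0}\theta_{\widetilde\gamma_0}$. $P$ is the quotient of $T^*M_K\times\mathbb R_\sigma$, a principal circle bundle over $N$. Put $$\eta_\gamma^{\mathrm{inst}}=\frac i{8\pi^2}\sum_{k>0}\frac{e^{ik\theta_\gamma}}k|Z_\gamma|K_1(2\pi k|Z_\gamma|)\Big(\frac{dZ_\gamma}{Z_\gamma}-\frac{d\overline Z_\gamma}{\overline Z_\gamma}\Big),\quad\eta^{\mathrm{inst}}=\sum_\gamma\Omega(\gamma)\eta_\gamma^{\mathrm{inst}}-\iota_V(g_N-\pi_M^*g_M),$$ $\eta=d\sigma-\frac1{4\pi}\langle\theta,d\theta\rangle+2\pi(-\frac12r^2\widetilde\eta+\eta^{\mathrm{inst}})$, $f=2\pi r^2-c+4\pi\sum_\gamma\Omega(\gamma)\iota_V\eta_\gamma^{\mathrm{inst}}$, $f_1=-2\pi r^2-c+4\pi\iota_V\eta^{\mathrm{inst}}$, $N'=\{f\ne0,f_1\ne0,g_N(X,X)\ne0\}\subset N$. On $P|_{N'}$: $g_P=\frac2{f_1}\eta^2+2\pi g_N$,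 $\theta_0^P=-\frac12df$, $\theta_1^P=\eta+\frac12\iota_X(2\pi g_N)$, $\theta_2^P=\frac12\iota_X(2\pi\omega_2)$, $\theta_3^P=-\frac12\iota_X(2\pi\omega_1)$; $\overline N=\{\mathrm{Arg}(z^0)=0\}\subset P|_{N'}$, $g_{\overline N}:=-\frac1f\big(g_P-\frac2f\sum_{i=0}^3(\theta_i^P)^2\big)\big|_{\overline N}$, $\overline N_+=\{f>0,f_1<0\}\subset\overline N$. **Universal hypermultiplet.** $\overline N_{\mathrm{UH}}:=\big((T^*\mathbb C^\times\times\mathbb R_\sigma)/\mathrm{Heis}(\Lambda^* )\big)\big|_{\mathbb R_{\rho>0}}$, where $\mathbb R_{\rho>0}=\{z^0\in\mathbb C^\times:\rho=2\pi|z^0|^2-c>0,\ \mathrm{Arg}(z^0)=0\}$; its points have coordinates $(\rho,\widetilde\theta_0=\theta_{\partial_{x^0}},\theta^0=\theta_{\partial_{y_0}},\sigma)$, and $$g_{\mathrm{FS}}^c=\frac{\rho+2c}{4(\rho+c)\rho^2}d\rho^2+\frac{4(\rho+c)}{\rho^2(\rho+2c)}\Big(d\sigma-\frac1{4\pi}\langle\theta,d\theta\rangle\Big)^2-\frac1{2\pi\rho}\Big(1-\frac{2(\rho+c)}\rho\Big)|W_0|^2,\qquad W_0=d\widetilde\theta_0-i\,d\theta^0.$$ Its only non-compact direction is $\rho$; for $\rho_0>0$ the end $\{\rho>\rho_0\}$ has finite volume and $\{0<\rho<\rho_0\}$ has infinite volume (known result). *)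

(* Defs.v *)
From HB Require Import structures.
From mathcomp Require Import all_boot all_order all_algebra.
From mathcomp Require Import generic_quotient complex.
From mathcomp Require Import all_classical all_reals all_analysis.
From mathcomp Require Import ring.

Set Implicit Arguments.
Unset Strict Implicit.
Unset Printing Implicit Defensive.

Import Order.TTheory GRing.Theory Num.Theory.
Import numFieldNormedType.Exports.
Import ComplexField.Normc.

Local Open Scope classical_set_scope.
Local Open Scope complex_scope.
Local Open Scope ring_scope.

(** Everything is written on the universal covers in the fibre directions:
    - a point of T^*M is q : 'rV[R]_4 with entries
      (Re z^0, Im z^0, theta_{d/dx^0}, theta_{d/dy_0}); z^0 = 0 is allowed by
      the type and is excluded by the sets below;
    - a point of T^*M x R_sigma is p : 'rV[R]_(4 + 1), the last entry being
      sigma.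
    Tangent vectors have the same types.  The coordinates z^0, Z_gamma,
    theta_gamma and sigma are linear in the entries, so their differentials
    are the same functions applied to tangent vectors; thus [Z g v] is
    dZ_gamma(v), [theta g v] is dtheta_gamma(v), and so on. *)

(** The lattice Lambda: (a, b) stands for a d/dx^0 + b d/dy_0.  The same type
    is used for Lambda^*, (a, b) being the values on (d/dx^0, d/dy_0). *)
Definition Lambda : Type := (int * int)%type.
Definition gamma_dx : Lambda := (1, 0).
Definition gamma_dy : Lambda := (0, 1).

Definition support_charges : seq Lambda := [:: gamma_dy; - gamma_dy].

Section Geometry.
Variable R : realType.

(** DLMF 10.32.9: K_nu(x) for x > 0. *)
Definition besselK (nu : nat) (x : R) : R :=
  \int[lebesgue_measure]_(t in `[0, +oo[)
    (expR (- (x * ((expR t + expR (- t)) / 2)))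
     * ((expR (nu%:R * t) + expR (- (nu%:R * t))) / 2)).

(** Sum over k > 0 of a complex series, through real and imaginary parts. *)
Definition sum_pos (u : nat -> R[i]) : R[i] :=
  limn (fun n => \sum_(1 <= k < n) complex.Re (u k)) +i*
  limn (fun n => \sum_(1 <= k < n) complex.Im (u k)).

Definition cis (t : R) : R[i] := cos t +i* sin t.

Section Forms.
Variable V : Type.

Definition wedge (S : pzRingType) (a b : V -> S) (u v : V) : S :=
  a u * b v - a v * b u.

(** <dA /\ dB> for Lambda^*-valued one-forms. *)
Definition pair_wedge (S : pzRingType) (A B : Lambda -> V -> S) (u v : V) : S :=
  wedge (A gamma_dx) (B gamma_dy) u v - wedge (A gamma_dy) (B gamma_dx) u v.

(** |a|^2 as a real symmetric bilinear form, for a complex-valued one-form a. *)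
Definition sqnorm_form (a : V -> R[i]) (u v : V) : R :=
  complex.Re (a u * conjc (a v)).

End Forms.

Definition zc (q : 'rV[R]_4) : R[i] :=
  q 0 (@Ordinal 4 0 isT) +i* q 0 (@Ordinal 4 1 isT).

Definition theta (g : Lambda) (q : 'rV[R]_4) : R :=
  g.1%:~R * q 0 (@Ordinal 4 2 isT) + g.2%:~R * q 0 (@Ordinal 4 3 isT).

(** Linear in gamma, with Z_{d/dx^0} = i z^0 and Z_{d/dy_0} = z^0. *)
Definition Z (g : Lambda) (q : 'rV[R]_4) : R[i] :=
  (g.2%:~R +i* g.1%:~R) * zc q.

Definition Zbar (g : Lambda) (q : 'rV[R]_4) : R[i] := conjc (Z g q).

Definition thetaC (g : Lambda) (q : 'rV[R]_4) : R[i] := (theta g q)%:C.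

Definition dlogZ (g : Lambda) (q v : 'rV[R]_4) : R[i] :=
  Z g v / Z g q - Zbar g v / Zbar g q.

Definition Vinst (g : Lambda) (q : 'rV[R]_4) : R[i] :=
  ((2 * pi)^-1)%:C *
  sum_pos (fun k => cis (k%:R * theta g q)
                    * (besselK 0 (2 * pi * k%:R * normc (Z g q)))%:C).

Definition Ainst (g : Lambda) (q v : 'rV[R]_4) : R[i] :=
  - ((4 * pi)^-1)%:C *
  sum_pos (fun k => cis (k%:R * theta g q)
    * (normc (Z g q) * besselK 1 (2 * pi * k%:R * normc (Z g q)))%:C)
  * dlogZ g q v.

Definition etainst_ (g : Lambda) (q v : 'rV[R]_4) : R[i] :=
  'i%C * ((8 * pi ^+ 2)^-1)%:C *
  sum_pos (fun k => cis (k%:R * theta g q) / k%:R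
    * (normc (Z g q) * besselK 1 (2 * pi * k%:R * normc (Z g q)))%:C)
  * dlogZ g q v.

Definition gM : 'rV[R]_4 -> 'rV[R]_4 -> R := sqnorm_form zc.

(** V, the horizontal lift of J xi: dz^0(V) = i z^0 and dtheta(V) = 0. *)
Definition Vfield (q : 'rV[R]_4) : 'rV[R]_4 :=
  \row_j nth 0 [:: - complex.Im (zc q); complex.Re (zc q); 0; 0] j.

Definition Xfield (q : 'rV[R]_4) : 'rV[R]_4 := 2 *: Vfield q.

(** r^2 tilde-eta = g_M(J xi, .) *)
Definition r2eta (q v : 'rV[R]_4) : R := gM (Vfield q) v.

Section Omega.
Variable Omega : Lambda -> int.

Definition omega12 (q u v : 'rV[R]_4) : R[i] :=
  - ((2 * pi)^-1)%:C * pair_wedge Z thetaC u v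
  + \sum_(g <- support_charges)
      ((Omega g)%:~R * wedge (Z g) (Ainst g q) u v
       + 'i%C * (Omega g)%:~R / (2 * pi)%:C * Vinst g q
         * wedge (thetaC g) (Z g) u v).

Definition omega3C (q u v : 'rV[R]_4) : R[i] :=
  4^-1 * pair_wedge Z Zbar u v
  - ((8 * pi ^+ 2)^-1)%:C * pair_wedge thetaC thetaC u v
  + \sum_(g <- support_charges)
      ('i%C * (Omega g)%:~R / 2 * Vinst g q * wedge (Z g) (Zbar g) u v
       + (Omega g)%:~R / (2 * pi)%:C * wedge (thetaC g) (Ainst g q) u v).

Definition omega1 q u v : R := complex.Re (omega12 q u v).
Definition omega2 q u v : R := complex.Im (omega12 q u v).
(** The charges gamma and - gamma contribute complex conjugate terms, so that
    omega3C and the sum of the eta_gamma^inst are real; taking real parts only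
    changes the codomain. *)
Definition omega3 q u v : R := complex.Re (omega3C q u v).

Definition form_mx (w : 'rV[R]_4 -> 'rV[R]_4 -> R) : 'M[R]_4 :=
  \matrix_(i, j) w (delta_mx 0 i) (delta_mx 0 j).

(** I_1 = - omega_2^{-1} o omega_3 with omega_a seen as u |-> omega_a(u, .);
    endomorphisms act on row vectors from the right. *)
Definition I1_mx (q : 'rV[R]_4) : 'M[R]_4 :=
  - (form_mx (omega3 q) *m invmx (form_mx (omega2 q))).

(** omega_1(u, v) = g_N(I_1 u, v) *)
Definition gN (q u v : 'rV[R]_4) : R :=
  (u *m (invmx (I1_mx q) *m form_mx (omega1 q)) *m v^T) 0 0.

Definition Tform (q u v : 'rV[R]_4) : R :=
  gM u v + complex.Re (\sum_(g <- support_charges)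
    (Omega g)%:~R * Vinst g q * (sqnorm_form (Z g) u v)%:C).

(** T is non-degenerate on TN / ker d(pi_M) over M_K = {|z^0| > K}. *)
Definition nondegenerate_over (K : R) : Prop :=
  forall q, K < normc (zc q) ->
  forall u, (forall v, Tform q u v = 0) -> zc u = 0.

Definition etainst (q v : 'rV[R]_4) : R :=
  complex.Re (\sum_(g <- support_charges) (Omega g)%:~R * etainst_ g q v)
  - (gN q (Vfield q) v - gM (Vfield q) v).

Section Level.
Variable c : R.

Definition f (q : 'rV[R]_4) : R :=
  2 * pi * normc (zc q) ^+ 2 - c
  + 4 * pi * complex.Re (\sum_(g <- support_charges)
      (Omega g)%:~R * etainst_ g q (Vfield q)).

Definition f1 (q : 'rV[R]_4) : R :=
  - (2 * pi * normc (zc q) ^+ 2) - c + 4 * pi * etainst q (Vfield q).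

Definition Nprime (K : R) : set 'rV[R]_4 :=
  [set q | [/\ 0 < normc (zc q), K < normc (zc q), f q != 0, f1 q != 0
             & gN q (Xfield q) (Xfield q) != 0]].

(** The projection P -> N and its differential. *)
Definition prN (p : 'rV[R]_(4 + 1)) : 'rV[R]_4 := lsubmx p.

Definition sigma (p : 'rV[R]_(4 + 1)) : R := rsubmx p 0 0.

Definition pairing (d : Lambda) (q : 'rV[R]_4) : R :=
  d.1%:~R * theta gamma_dy q - d.2%:~R * theta gamma_dx q.

(** dsigma - (1 / 4 pi) <theta, dtheta> *)
Definition dsigma_theta (p v : 'rV[R]_(4 + 1)) : R :=
  sigma v - (4 * pi)^-1 *
    (theta gamma_dx (prN p) * theta gamma_dy (prN v)
     - theta gamma_dy (prN p) * theta gamma_dx (prN v)).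

Definition eta (p v : 'rV[R]_(4 + 1)) : R :=
  dsigma_theta p v
  + 2 * pi * (- (2^-1 * r2eta (prN p) (prN v)) + etainst (prN p) (prN v)).

Definition gP (p u v : 'rV[R]_(4 + 1)) : R :=
  2 / f1 (prN p) * (eta p u * eta p v)
  + 2 * pi * gN (prN p) (prN u) (prN v).

Definition thetaP0 (p v : 'rV[R]_(4 + 1)) : R :=
  - (2^-1 * 'D_(prN v) f (prN p)).
Definition thetaP1 (p v : 'rV[R]_(4 + 1)) : R :=
  eta p v + 2^-1 * (2 * pi * gN (prN p) (Xfield (prN p)) (prN v)).
Definition thetaP2 (p v : 'rV[R]_(4 + 1)) : R :=
  2^-1 * (2 * pi * omega2 (prN p) (Xfield (prN p)) (prN v)).
Definition thetaP3 (p v : 'rV[R]_(4 + 1)) : R :=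
  - (2^-1 * (2 * pi * omega1 (prN p) (Xfield (prN p)) (prN v))).

(** g_{overline N}, to be evaluated at points of the slice Arg z^0 = 0 and on
    vectors tangent to it. *)
Definition gNbar (p u v : 'rV[R]_(4 + 1)) : R :=
  - (f (prN p))^-1 *
  (gP p u v - 2 / f (prN p) *
     (thetaP0 p u * thetaP0 p v + thetaP1 p u * thetaP1 p v
      + thetaP2 p u * thetaP2 p v + thetaP3 p u * thetaP3 p v)).

End Level.
End Omega.

(** Arg z^0 = 0 *)
Definition slice : set 'rV[R]_(4 + 1) :=
  [set p | 0 < complex.Re (zc (prN p)) /\ complex.Im (zc (prN p)) = 0].

Definition slice_tangent : set 'rV[R]_(4 + 1) :=
  [set v | complex.Im (zc (prN v)) = 0].

(** The action of (2 pi d, pi k), d in Lambda^* and k in Z. *)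
Definition heis (d : Lambda) (k : int) (p : 'rV[R]_(4 + 1)) :
    'rV[R]_(4 + 1) :=
  row_mx (prN p + \row_j nth 0 [:: 0; 0; 2 * pi * d.1%:~R; 2 * pi * d.2%:~R] j)
         (sigma p + pi * k%:~R + 2^-1 * pairing d (prN p))%:M.

Definition heis_rel (p q : 'rV[R]_(4 + 1)) : bool :=
  `[< exists d k, q = heis d k p >].

Lemma theta_heis g d k p :
  theta g (prN (heis d k p)) =
  theta g (prN p) + 2 * pi * (g.1%:~R * d.1%:~R + g.2%:~R * d.2%:~R).
Proof. by rewrite /heis /prN row_mxKl /theta !mxE /=; ring. Qed.

Lemma sigma_heis d k p :
  sigma (heis d k p) = sigma p + pi * k%:~R + 2^-1 * pairing d (prN p).
Proof. by rewrite /heis {1}/sigma row_mxKr mxE eqxx mulr1n. Qed.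

Lemma heis_eq d k p q :
  prN q = prN p + \row_j nth 0 [:: 0; 0; 2 * pi * d.1%:~R; 2 * pi * d.2%:~R] j ->
  sigma q = sigma p + pi * k%:~R + 2^-1 * pairing d (prN p) ->
  q = heis d k p.
Proof.
move=> hq hs; rewrite /heis -hq -hs -[LHS]hsubmxK; congr row_mx.
by rewrite [LHS]mx11_scalar.
Qed.

Lemma heisM d k d' k' p :
  heis d k (heis d' k' p) =
  heis (d + d') (k + k' + (d.1 * d'.2 - d.2 * d'.1)) p.
Proof.
apply: heis_eq.
  rewrite /heis /prN !row_mxKl -addrA; congr (_ + _); apply/rowP => j; rewrite !mxE.
  by case: j => [[|[|[|[|//]]]] hj] //=; rewrite ?addr0 //; ring.
by rewrite !sigma_heis /pairing !theta_heis /=; field.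
Qed.

Lemma heis1 p : heis 0 0 p = p.
Proof.
apply/esym/heis_eq; last by rewrite /pairing /=; ring.
rewrite -[LHS]addr0; congr (_ + _); apply/rowP => j; rewrite !mxE.
by case: j => [[|[|[|[|//]]]] hj] //=; ring.
Qed.

Lemma heisV d k p : heis (- d) (- k) (heis d k p) = p.
Proof.
rewrite heisM -[RHS]heis1; congr heis; first by rewrite addNr.
by rewrite /=; ring.
Qed.

Lemma heis_rel_refl : reflexive heis_rel.
Proof. by move=> p; apply/asboolP; exists 0, 0; rewrite heis1. Qed.

Lemma heis_rel_sym : symmetric heis_rel.
Proof.
move=> p q; apply/asboolP/asboolP => -[d [k ->]];
  by exists (- d), (- k); rewrite heisV.
Qed.

Lemma heis_rel_trans : transitive heis_rel.
Proof.
move=> q p r /asboolP[d [k ->]] /asboolP[d' [k' ->]]; apply/asboolP.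
by eexists; eexists; rewrite heisM.
Qed.

Definition heis_equiv : equiv_rel 'rV[R]_(4 + 1) :=
  EquivRel heis_rel heis_rel_refl heis_rel_sym heis_rel_trans.

Definition heis_quot : Type := {eq_quot heis_equiv}%qT.
Definition projP (p : 'rV[R]_(4 + 1)) : heis_quot := (\pi_{eq_quot heis_equiv} p)%qT.

Section Level.
Variable c : R.

Definition rho (p : 'rV[R]_(4 + 1)) : R :=
  2 * pi * normc (zc (prN p)) ^+ 2 - c.

Definition Nbar_plus (Omega : Lambda -> int) (K : R) : set heis_quot :=
  projP @` [set p | [/\ slice p, Nprime Omega c K (prN p),
                       0 < f Omega c (prN p) & f1 Omega c (prN p) < 0]].

Definition N_UH : set heis_quot := projP @` [set p | slice p /\ 0 < rho p].

Definition W0 (v : 'rV[R]_(4 + 1)) : R[i] :=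
  theta gamma_dx (prN v) -i* theta gamma_dy (prN v).

(** The metric g_FS^c, as a tensor along the slice Arg z^0 = 0. *)
Definition gFS (p u v : 'rV[R]_(4 + 1)) : R :=
  (rho p + 2 * c) / (4 * (rho p + c) * rho p ^+ 2)
    * ('D_u rho p * 'D_v rho p)
  + 4 * (rho p + c) / (rho p ^+ 2 * (rho p + 2 * c))
    * (dsigma_theta p u * dsigma_theta p v)
  - (2 * pi * rho p)^-1 * (1 - 2 * (rho p + c) / rho p)
    * sqnorm_form W0 u v.

(** Since the other directions are compact, the sets {rho > rho0} are a basis
    of neighbourhoods of the end rho -> oo. *)
Definition rho_above (rho0 : R) : set heis_quot :=
  projP @` [set p | [/\ slice p, 0 < rho p & rho0 < rho p]].

Definition rho_below (rho0 : R) : set heis_quot :=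
  projP @` [set p | [/\ slice p, 0 < rho p & rho p < rho0]].

Definition end_nbhd (U : set heis_quot) : Prop :=
  U `<=` N_UH /\ exists2 rho0 : R, 0 < rho0 & rho_above rho0 `<=` U.

Definition slice_pt (x a b s : R) : 'rV[R]_(4 + 1) :=
  \row_j nth 0 [:: x; 0; a; b; s] j.

(** Gram matrix of g_FS^c in the coordinate frame
    (d/d(Re z^0), d/dtheta_{d/dx^0}, d/dtheta_{d/dy_0}, d/dsigma). *)
Definition gramFS (p : 'rV[R]_(4 + 1)) : 'M[R]_4 :=
  \matrix_(i, j) gFS p (delta_mx 0 (lift (@Ordinal 5 1 isT) i))
                       (delta_mx 0 (lift (@Ordinal 5 1 isT) j)).

Definition half_line : set R := `]0, +oo[.
Definition period (L : R) : set R := `[0, L[.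

(** g_FS^c-volume: the integral of the volume density over the fundamental
    domain [0, 2 pi[ x [0, 2 pi[ x [0, pi[ of the Heisenberg group. *)
Definition volFS (A : set heis_quot) : \bar R :=
  (\int[lebesgue_measure]_(x in half_line)
   \int[lebesgue_measure]_(a in period (2 * pi))
   \int[lebesgue_measure]_(b in period (2 * pi))
   \int[lebesgue_measure]_(s in period pi)
     (\1_A (projP (slice_pt x a b s))
      * Num.sqrt (\det (gramFS (slice_pt x a b s))))%:E)%E.

End Level.

(** g restricts to an inner product on the tangent vectors in T. *)
Definition inner_product_on (T : set 'rV[R]_(4 + 1))
    (g : 'rV[R]_(4 + 1) -> 'rV[R]_(4 + 1) -> R) : Prop :=
  [/\ forall a u v w, T u -> T v -> T w -> g (a *: u + v) w = a * g u w + g v w,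
      forall u v, T u -> T v -> g u v = g v u
    & forall u, T u -> u != 0 -> 0 < g u u].

(** The tensor g, given on the cover along the slice, is invariant at p under
    the Heisenberg group, hence descends to the quotient. *)
Definition heis_invariant_at (g : 'rV[R]_(4 + 1) -> 'rV[R]_(4 + 1) ->
    'rV[R]_(4 + 1) -> R) (p : 'rV[R]_(4 + 1)) : Prop :=
  forall d k u v, slice_tangent u -> slice_tangent v ->
    g (heis d k p) ('D_u (heis d k) p) ('D_v (heis d k) p) = g p u v.

End Geometry.

(* Main.v *)
Require Import Defs.
From mathcomp Require Import all_boot all_order all_algebra.
From mathcomp Require Import complex.
From mathcomp Require Import all_classical all_reals all_analysis.
From mathcomp Require Import measurable_realfun ring lra.
Import Order.TTheory GRing.Theory Num.Theory.
Import numFieldNormedType.Exports.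
Set Implicit Arguments.
Unset Strict Implicit.
Unset Printing Implicit Defensive.
Local Open Scope classical_set_scope.
Local Open Scope ring_scope.

(** The computation takes place on the slice Arg z^0 = 0, where everything
    becomes explicit.  Write r = |z^0|, theta for theta_{d/dy_0}, let W be 1
    plus the total instanton potential, and let C and s be multiples of the
    sums over k of cos (k theta) r K_1(2 pi k r) / k and of
    sin (k theta) r K_1(2 pi k r).  There (omega_1, omega_2, omega_3) is the
    Gibbons-Hawking triple of the potential W ([omega12_slice],
    [omega3_slice]), so that g_N is the Gibbons-Hawking metric ([gN_slice]).
    The derivative of the level function f brings in W and s again, because
    (x K_1)' = - x K_0 ([is_derive_xK1], [derive_f]); this is what makes all
    cross terms of g_{overline N} cancel except one.  The outcome
    ([gNbar_slice], [qk_form]) is a quadratic form in dr, the two dtheta and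
    dsigma - <theta, dtheta> / 4 pi which, after completing one square, is a
    sum of squares with positive coefficients as soon as f > 0, f_1 < 0 and
    W > 0 ([qk_form_gt0]).

    These three inequalities hold for large r: the Bessel integrals decay
    exponentially, so W tends to 1 and C stays bounded, while f and f_1 are
    dominated by 2 pi r^2 and - 2 pi r^2 ([instanton_bounds]).  The instanton
    sums are 2 pi-periodic in theta, and the form
    dsigma - <theta, dtheta> / 4 pi is preserved by the Heisenberg action, so
    the metric descends to the quotient.  Since rho = 2 pi r^2 - c, a set
    {rho > rho_0} with rho_0 large is the required neighborhood of the end
    ([end_nbhd_exists]).

    With Omega = 0 the same formula has W = 1 and s = 0 and is g_FS^c
    ([gNbar0]).  In the coordinates (r, theta, sigma) the volume density of
    g_FS^c is 2 r (rho + 2 c) / rho^4 ([det_gramFS]), which is integrable at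
    rho = oo and not at rho = 0 ([volFS_above], [volFS_below]). *)

(** * The Bessel functions K_0 and K_1 *)

Section BesselIntegral.
Variable R : realType.
Implicit Types (x t : R) (j k : nat).
Local Notation leb := (@lebesgue_measure R).
Local Notation Rpos := (`[0%R, +oo[%classic : set R).

Definition ch t : R := (expR t + expR (- t)) / 2.
Definition sh t : R := (expR t - expR (- t)) / 2.

Definition cosh_moment j x : R :=
  \int[leb]_(t in Rpos) (expR (- (x * ch t)) * ch t ^+ j).

Lemma besselK0E x : besselK 0 x = cosh_moment 0 x.
Proof.
rewrite /besselK /cosh_moment; apply: eq_Rintegral => t _.
by rewrite mul0r oppr0 expR0 expr0 divff ?pnatr_eq0.
Qed.

Lemma besselK1E x : besselK 1 x = cosh_moment 1 x.
Proof.
by rewrite /besselK /cosh_moment; apply: eq_Rintegral => t _; rewrite mul1r.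
Qed.

Lemma ch_ge1 t : 1 <= ch t.
Proof.
rewrite /ch expRN; have := expR_gt0 t; move: (expR t) => y y0.
rewrite ler_pdivlMr// mul1r -subr_ge0.
rewrite (_ : _ - _ = (y - 1) ^+ 2 / y); last by field; rewrite gt_eqF.
by apply: divr_ge0; [exact: sqr_ge0|exact: ltW].
Qed.

Lemma ch_gt0 t : 0 < ch t. Proof. exact: lt_le_trans (ch_ge1 t). Qed.

Lemma ch_le_expR t : 0 <= t -> ch t <= expR t.
Proof.
move=> t0; rewrite /ch ler_pdivrMr// mulr_natr mulr2n lerD2l ler_expR.
by rewrite (le_trans _ t0)// oppr_le0.
Qed.

Lemma expR_le_ch t : expR t <= 2 * ch t.
Proof. by rewrite /ch mulrC divfK ?pnatr_eq0// lerDl expR_ge0. Qed.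

(** A power of y = exp t is beaten by exp (- (x / 2) y), since
    exp u >= (u / n) ^ n; one more power than needed leaves a factor
    exp (- t). *)
Definition moment_const j x : R := (2 * j.+1%:R / x) ^+ j.+1.

Lemma cosh_moment_kernel_le j x t : 0 < x -> 0 <= t ->
  expR (- (x * ch t)) * ch t ^+ j <= moment_const j x * expR (- t).
Proof.
move=> x0 t0.
have n0 : 0 < j.+1%:R :> R by rewrite ltr0n.
apply: (@le_trans _ _ (expR (- (x / 2 * expR t)) * expR t ^+ j)).
  apply: ler_pM; rewrite ?expR_ge0 ?exprn_ge0 ?(ltW (ch_gt0 _))//.
    rewrite ler_expR lerN2 -mulrA ler_pM2l// ler_pdivrMl//.
    exact: expR_le_ch.
  by rewrite lerXn2r ?nnegrE ?expR_ge0 ?(ltW (ch_gt0 _))// ch_le_expR.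
rewrite expRN [expR (- t)]expRN /moment_const.
have y0 := expR_gt0 t; move: (expR t) y0 => y y0.
rewrite ler_pdivlMr// -(mulrA _ (y ^+ j)) -exprSr ler_pdivrMl ?expR_gt0//.
rewrite [X in X ^+ _ <= _](_ : y = x / 2 * y / j.+1%:R * (2 * j.+1%:R / x));
  last by field; rewrite !gt_eqF.
rewrite exprMn; apply: ler_wpM2r; first by rewrite exprn_ge0// divr_ge0 ?mulr_ge0// ltW.
set u := _ * y.
rewrite -[u in leRHS](@divfK _ j.+1%:R) ?gt_eqF// expRM_natr.
have u0 : 0 <= u / j.+1%:R by rewrite !mulr_ge0 ?invr_ge0// ltW.
rewrite lerXn2r ?nnegrE ?expR_ge0//.
by apply: le_trans (expR_ge1Dx _); rewrite lerDr.
Qed.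

Lemma continuous_expRN : continuous (fun t : R => expR (- t)).
Proof.
move=> t; apply: (@continuous_comp _ _ _ (@GRing.opp R) expR).
  exact: opp_continuous.
exact: continuous_expR.
Qed.

Lemma continuous_ch : continuous ch.
Proof.
move=> t; apply: cvgM; last exact: cvg_cst.
by apply: cvgD; [exact: continuous_expR|exact: continuous_expRN].
Qed.

Lemma continuous_kernel j x :
  continuous (fun t => expR (- (x * ch t)) * ch t ^+ j).
Proof.
move=> t; apply: cvgM.
  apply: (@continuous_comp _ _ _ (fun t => - (x * ch t)) expR).
    by apply: cvgN; apply: cvgM; [exact: cvg_cst|exact: continuous_ch].
  exact: continuous_expR.
apply: (@continuous_comp _ _ _ ch (fun y => y ^+ j)).
  exact: continuous_ch.
exact: exprn_continuous.
Qed.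

Lemma kernel_ge0 j x t : 0 <= expR (- (x * ch t)) * ch t ^+ j.
Proof. by rewrite mulr_ge0 ?expR_ge0 ?exprn_ge0 ?(ltW (ch_gt0 _)). Qed.

Lemma is_derive_expRN t : is_derive t 1 (fun t : R => expR (- t)) (- expR (- t)).
Proof.
have := @is_derive1_comp R expR (@GRing.opp R) t _ _
  (is_derive_expR (- t)) (is_deriveN (is_derive_id t 1)).
by rewrite mulrN1.
Qed.

Lemma integral_expRN A : 0 <= A ->
  (\int[leb]_(t in Rpos) (A * expR (- t))%:E)%E = A%:E.
Proof.
move=> A0.
have dF t : is_derive t 1 (fun t => - (A * expR (- t))) (A * expR (- t)).
  have := is_deriveN (is_deriveZ A (is_derive_expRN t)).
  by rewrite scalerN opprK.
rewrite (@ge0_continuous_FTC2y _ _ (fun t => - (A * expR (- t))) _ 0).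
- by rewrite oppr0 expR0 -EFinB sub0r opprK mulr1.
- by move=> t _; rewrite mulr_ge0// expR_ge0.
- apply: continuous_subspaceT => t.
  by apply: cvgM; [exact: cvg_cst|exact: continuous_expRN].
- rewrite -oppr0 -[X in _ --> - X](mulr0 A).
  by apply: cvgN; apply: cvgM; [exact: cvg_cst|exact: cvgr_expR].
- by move=> t _; apply: (@ex_derive _ _ _ _ _ _ _ (dF t)).
- apply: cvg_at_right_filter; apply: cvgN; apply: cvgM; first exact: cvg_cst.
  exact: continuous_expRN.
- by move=> t _; rewrite derive1E; apply: derive_val.
Qed.

Lemma integrable_expRN A : 0 <= A ->
  leb.-integrable Rpos (EFin \o (fun t => A * expR (- t))).
Proof.
move=> A0; apply/integrableP; split.
  apply/measurable_EFinP; apply: measurable_funTS.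
  apply: continuous_measurable_fun => t.
  by apply: cvgM; [exact: cvg_cst|exact: continuous_expRN].
apply: (@le_lt_trans _ _ A%:E); last exact: ltry.
rewrite le_eqVlt; apply/orP; left; apply/eqP.
rewrite -[RHS]integral_expRN//; apply: eq_integral => t _ /=.
by rewrite ger0_norm// mulr_ge0// expR_ge0.
Qed.

Lemma integrable_kernel j x : 0 < x ->
  leb.-integrable Rpos (EFin \o (fun t => expR (- (x * ch t)) * ch t ^+ j)).
Proof.
move=> x0.
have C0 : 0 <= moment_const j x.
  by rewrite exprn_ge0 // divr_ge0 ?mulr_ge0// ltW.
apply: (le_integrable _ _ _ (integrable_expRN C0)) => //.
  apply/measurable_EFinP; apply: measurable_funTS.
  by apply: continuous_measurable_fun; exact: continuous_kernel.
move=> t; rewrite /= in_itv /= andbT => t0.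
rewrite lee_fin !ger0_norm ?kernel_ge0 ?mulr_ge0 ?expR_ge0//.
exact: cosh_moment_kernel_le.
Qed.

Let integrableZl_EFin (a : R) (g : R -> R) :
  leb.-integrable Rpos (EFin \o g) ->
  leb.-integrable Rpos (EFin \o (fun t => a * g t)).
Proof. by move=> ig; apply: (integrableZl _ a ig). Qed.

Lemma cosh_moment_ge0 j x : 0 <= cosh_moment j x.
Proof.
by rewrite /cosh_moment; apply: Rintegral_ge0 => t _; exact: kernel_ge0.
Qed.

(** Half of the exponent is spent on the decay, by cosh >= 1; the other half
    keeps the integral convergent. *)
Lemma cosh_moment_decay j x : 2 <= x ->
  cosh_moment j x <= expR (- (x / 2)) * cosh_moment j 1.
Proof.
move=> x2; rewrite /cosh_moment -RintegralZl//; last exact: integrable_kernel.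
apply: le_Rintegral => //.
- by apply: integrable_kernel; exact: lt_le_trans x2.
- by apply: integrableZl_EFin; exact: integrable_kernel.
move=> t _; rewrite mulrA ler_wpM2r ?exprn_ge0 ?(ltW (ch_gt0 _))//.
rewrite -expRD ler_expR -opprD lerN2 mul1r.
by have := ch_ge1 t; nra.
Qed.

Lemma is_derive_ch t : is_derive t 1 ch (sh t).
Proof.
have := is_deriveM (is_deriveD (is_derive_expR t) (is_derive_expRN t))
  (is_derive_cst (2^-1 : R) t 1).
by rewrite scaler0 add0r /sh -[_ *: _]mulrC.
Qed.

Lemma is_derive_sh t : is_derive t 1 sh (ch t).
Proof.
have := is_deriveM (is_deriveB (is_derive_expR t) (is_derive_expRN t))
  (is_derive_cst (2^-1 : R) t 1).
by rewrite scaler0 add0r opprK /ch -[_ *: _]mulrC.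
Qed.

Lemma sh_sqr t : sh t ^+ 2 = ch t ^+ 2 - 1.
Proof. by rewrite /sh /ch expRN; field; rewrite gt_eqF ?expR_gt0. Qed.

(** Integration by parts: the integrand is the derivative of
    sinh t exp (- x cosh t), which vanishes at both ends.  Adding
    A exp (- t) makes that derivative nonnegative. *)
Lemma cosh_moment1E x : 0 < x ->
  cosh_moment 1 x = x * (cosh_moment 2 x - cosh_moment 0 x).
Proof.
move=> x0.
pose e j t := expR (- (x * ch t)) * ch t ^+ j.
pose A := x * moment_const 2 x.
have A0 : 0 <= A.
  by rewrite mulr_ge0 ?(ltW x0)// exprn_ge0// divr_ge0 ?mulr_ge0// ltW.
have ie j : leb.-integrable Rpos (EFin \o e j) by exact: integrable_kernel.
have ike j : leb.-integrable Rpos (EFin \o (fun t => x * e j t)).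
  exact: integrableZl_EFin.
pose k t := e 1%N t - x * e 2%N t + x * e 0%N t.
have dG t : is_derive t 1 (fun t => sh t * expR (- (x * ch t))) (k t).
  have := is_deriveM (is_derive_sh t) (@is_derive1_comp R expR
    (fun t => - (x * ch t)) t _ _ (is_derive_expR (- (x * ch t)))
    (is_deriveN (is_deriveZ x (is_derive_ch t)))).
  move=> /is_derive_eq; apply.
  rewrite /k /e expr1 expr0 mulr1 -[_ *: ch t]/(_ * ch t).
  rewrite -[sh t *: _]/(sh t * _) -[x *: _]/(x * _).
  have := sh_sqr t; rewrite !expr2 => sh2.
  rewrite (_ : sh t * _ = - x * expR (- (x * ch t)) * (sh t * sh t)); last by ring.
  by rewrite sh2 /=; ring.
have k_ge t : 0 <= t -> 0 <= k t + A * expR (- t).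
  move=> t0; rewrite /k; have := cosh_moment_kernel_le 2 x0 t0.
  rewrite -(ler_pM2l x0) [X in _ <= X]mulrA => h.
  have h1 : 0 <= e 1%N t by exact: kernel_ge0.
  have h0 : 0 <= x * e 0%N t by apply: mulr_ge0; [exact: ltW|exact: kernel_ge0].
  have {}h : x * e 2%N t <= A * expR (- t) by exact: h.
  by lra.
have ck : continuous k.
  move=> t; apply: cvgD; first apply: cvgB.
  - exact: continuous_kernel.
  - by apply: cvgM; [exact: cvg_cst|exact: continuous_kernel].
  - by apply: cvgM; [exact: cvg_cst|exact: continuous_kernel].
have ik : leb.-integrable Rpos (EFin \o k).
  exact: (integrableD _ (integrableB _ (ie 1%N) (ike 2%N)) (ike 0%N)).
have : \int[leb]_(t in Rpos) (k t + A * expR (- t)) = A.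
  pose G t := sh t * expR (- (x * ch t)) - A * expR (- t).
  have dG' t : is_derive t 1 G (k t + A * expR (- t)).
    have := is_deriveB (dG t) (is_deriveZ A (is_derive_expRN t)).
    by rewrite scalerN opprK.
  rewrite (@Rintegral_ge0_continuous_FTC2y _ _ G _ 0).
  - by rewrite /G /sh oppr0 expR0 subrr !mul0r !sub0r opprK mulr1.
  - by move=> t; exact: k_ge.
  - apply: continuous_subspaceT => t; apply: cvgD; first exact: ck.
    by apply: cvgM; [exact: cvg_cst|exact: continuous_expRN].
  - rewrite /G -[X in _ --> X](subrr 0); apply: cvgB; last first.
      rewrite -[X in _ --> X](mulr0 A).
      by apply: cvgM; [exact: cvg_cst|exact: cvgr_expR].
    pose B := moment_const 1 x.
    have cB : B * expR (- t) @[t --> +oo] --> (0 : R).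
      rewrite -[X in _ --> X](mulr0 B).
      by apply: cvgM; [exact: cvg_cst|exact: cvgr_expR].
    apply: (@squeeze_cvgr _ _ _ _ (fun t => - (B * expR (- t)))
      (fun t => B * expR (- t))) => //; last by rewrite -oppr0; apply: cvgN.
    near=> t.
    rewrite -ler_norml normrM [`|expR _|]gtr0_norm ?expR_gt0//.
    have t0 : 0 <= t by near: t; exact: nbhs_pinfty_ge.
    apply: le_trans (cosh_moment_kernel_le 1 x0 t0).
    rewrite mulrC expr1 ler_wpM2l ?expR_ge0// /sh /ch normrM.
    rewrite [`|2^-1|]gtr0_norm// ler_pM2r// ler_norml.
    by have := expR_gt0 t; have := expR_gt0 (- t); lra.
  - by move=> t _; apply: (@ex_derive _ _ _ _ _ _ _ (dG' t)).
  - apply: cvg_at_right_filter; apply/differentiable_continuous/derivable1_diffP.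
    exact: (@ex_derive _ _ _ _ _ _ _ (dG' 0)).
  - by move=> t _; rewrite derive1E; apply: derive_val.
rewrite RintegralD//; last exact: integrable_expRN.
rewrite [X in _ + X]/Rintegral integral_expRN//= => /(canRL (addrK _)).
rewrite subrr /k RintegralD//; last first.
  exact: (integrableB _ (ie 1%N) (ike 2%N)).
rewrite RintegralB// !RintegralZl// -!/(cosh_moment _ _) => h.
by move: h; rewrite -/(cosh_moment _ _); lra.
Unshelve. all: end_near. Qed.

(** Differentiation under the integral sign; on ]x / 2, x + 1[ the derivatives
    of the integrand are dominated by their value at x / 2. *)
Lemma is_derive_cosh_moment j x : 0 < x ->
  is_derive x 1 (cosh_moment j) (- cosh_moment j.+1 x).
Proof.
move=> x0.
pose k y t := expR (- (y * ch t)) * ch t ^+ j.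
have dk (y t : R) : is_derive y 1 (k ^~ t) (- (expR (- (y * ch t)) * ch t ^+ j.+1)).
  have := is_deriveM (@is_derive1_comp R expR (fun y => - (y * ch t)) y _ _
    (is_derive_expR (- (y * ch t)))
    (is_deriveN (is_deriveM (is_derive_id y 1) (is_derive_cst (ch t) y 1))))
    (is_derive_cst (ch t ^+ j) y 1).
  move=> /is_derive_eq; apply.
  by rewrite /GRing.scale /= exprS; ring.
have Ix : `](x / 2), (x + 1)[%classic x.
  by rewrite /= in_itv /= ltrDl ltr01 andbT ltr_pdivrMr// ltr_pMr// ltr1n.
have pos y : `](x / 2), (x + 1)[%classic y -> x / 2 <= y.
  by rewrite /= in_itv /= => /andP[/ltW].
have x20 : 0 < x / 2 by rewrite divr_gt0.
have ik y : `](x / 2), (x + 1)[%classic y -> leb.-integrable Rpos (EFin \o k y).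
  by move=> /pos xy; apply: integrable_kernel; exact: lt_le_trans xy.
have derk y t : `](x / 2), (x + 1)[%classic y -> Rpos t ->
    derivable (k ^~ t) y 1.
  by move=> _ _; exact: (@ex_derive _ _ _ _ _ _ _ (dk y t)).
have bk y t : `](x / 2), (x + 1)[%classic y -> Rpos t ->
    `|partial1of2 k y t| <= expR (- (x / 2 * ch t)) * ch t ^+ j.+1.
  move=> /pos xy _; rewrite partial1of2E (@derive_val _ _ _ _ _ _ _ (dk y t)).
  rewrite normrN ger0_norm ?kernel_ge0// ler_wpM2r//.
    by rewrite exprn_ge0 ?(ltW (ch_gt0 _)).
  by rewrite ler_expR lerN2 ler_wpM2r// (ltW (ch_gt0 _)).

have iG := integrable_kernel j.+1 x20.
have G0 t : 0 <= expR (- (x / 2 * ch t)) * ch t ^+ j.+1 by exact: kernel_ge0.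
apply: DeriveDef.
  by apply: (@derivable_under_integral _ _ _ leb k Rpos _ _ _ _ Ix ik derk _ G0 iG bk).
rewrite -derive1E.
have -> : (cosh_moment j)^`()%classic x = \int[leb]_(t in Rpos) partial1of2 k x t.
  by apply: (@differentiation_under_integral _ _ _ leb k Rpos _ _ _ _ Ix ik
    derk _ G0 iG bk).
rewrite /cosh_moment -mulN1r -RintegralZl//; last exact: integrable_kernel.
apply: eq_Rintegral => t _; rewrite mulN1r -[LHS]/(partial1of2 k x t) partial1of2E.
exact: (@derive_val _ _ _ _ _ _ _ (dk x t)).
Qed.

(** The Bessel relation (x K_1(x))' = - x K_0(x). *)
Lemma is_derive_xK1 x : 0 < x ->
  is_derive x 1 (fun y => y * cosh_moment 1 y) (- (x * cosh_moment 0 x)).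
Proof.
move=> x0.
have := is_deriveM (is_derive_id x 1) (is_derive_cosh_moment 1 x0).
move=> /is_derive_eq; apply.
rewrite /GRing.scale /=; by have := cosh_moment1E x0; lra.
Qed.

End BesselIntegral.

(** * Termwise differentiation of series *)

Section TermwiseDerivative.
Variable R : realType.
Implicit Types (a M : nat -> R).

Lemma le_lim_series_tail a M N : (forall k, `|a k| <= M k) ->
  cvgn (series M) ->
  `|limn (series a) - series a N| <= limn (series M) - series M N.
Proof.
move=> aM cM.
have ca : cvgn (series a).
  apply: normed_cvg; apply: (series_le_cvg _ _ aM cM) => // k.
  exact: le_trans (aM k).
have le_n n : (N <= n)%N -> `|series a n - series a N| <= series M n - series M N.
  move=> Nn; rewrite !sub_series_geq//.
  by rewrite (le_trans (ler_norm_sum _ _ _))// ler_sum.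
have c1 : (fun n => `|series a n - series a N|) @ \oo -->
    `|limn (series a) - series a N|.
  by apply: cvg_norm; apply: cvgB; [exact: ca|exact: cvg_cst].
have c2 : (fun n => series M n - series M N) @ \oo -->
    limn (series M) - series M N.
  by apply: cvgB; [exact: cM|exact: cvg_cst].
apply: (ler_cvg_to c1 c2); near=> n; apply: le_n; near: n.
exact: nbhs_infty_ge.
Unshelve. all: end_near. Qed.

Lemma le_norm_sub_derive (u u' : R -> R) (M d h : R) :
  (forall x : R, `|x| < d -> is_derive x 1 u (u' x)) ->
  (forall x, `|x| < d -> `|u' x| <= M) -> `|h| < d ->
  `|u h - u 0| <= M * `|h|.
Proof.
move=> du u'M hd.
have sub (a b x : R) : `|a| < d -> `|b| < d -> x \in `[a, b] -> `|x| < d.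
  rewrite !ltr_norml !in_itv/= => /andP[? ?] /andP[? ?] /andP[? ?].
  by apply/andP; split; lra.
have key (a b : R) : `|a| < d -> `|b| < d -> a < b -> `|u b - u a| <= M * `|b - a|.
  move=> ad bd ab.
  have dab x : x \in `]a, b[ -> is_derive x 1 u (u' x).
    by move=> xab; apply/du/(sub a b)=> //; exact: subset_itv_oo_cc xab.
  have cu : {within `[a, b], continuous u}.
    apply: derivable_within_continuous => x xab.
    exact: (@ex_derive _ _ _ _ _ _ _ (du _ (sub _ _ _ ad bd xab))).
  have [x xab ->] := MVT ab dab cu.
  rewrite normrM ler_wpM2r// u'M// (sub a b)//; exact: subset_itv_oo_cc xab.
have d0 : `|0 : R| < d by rewrite normr0; exact: le_lt_trans hd.
have [h0|h0|->] := ltgtP h 0; last by rewrite subrr normr0 mulr0.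
- by rewrite distrC -[`|h|]normrN -(sub0r h); apply: key.
- by rewrite -[X in _ * `|X|]subr0; apply: key.
Qed.

(** Weierstrass's theorem on termwise differentiation; the mean value theorem
    lets the bound on the derivatives control the difference quotients. *)
Lemma is_derive_series (u u' : nat -> R -> R) M d : 0 < d ->
  (forall k (x : R), `|x| < d -> is_derive x 1 (u k) (u' k x)) ->
  (forall k x, `|x| < d -> `|u' k x| <= M k) ->
  (forall x, `|x| < d -> cvgn (series (u ^~ x))) ->
  cvgn (series M) ->
  is_derive (0 : R) 1 (fun x => limn (series (u ^~ x)))
    (limn (series (u' ^~ 0))).
Proof.
move=> d0 du u'M cu cM.
pose q h k := h^-1 * (u k h - u k 0).
have normd0 : `|0 : R| < d by rewrite normr0.
have qM h k : h != 0 -> `|h| < d -> `|q h k| <= M k.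
  move=> h0 hd; rewrite normrM normfV ler_pdivrMl ?normr_gt0// mulrC.
  exact: (le_norm_sub_derive (du k) (u'M k) hd).
have q_lim h : `|h| < d ->
    limn (series (q h)) = h^-1 * (limn (series (u ^~ h)) - limn (series (u ^~ 0))).
  move=> hd; apply: cvg_lim => //.
  rewrite (_ : series (q h) = fun n => h^-1 * (series (u ^~ h) n - series (u ^~ 0) n)).
    apply: cvgM; first exact: cvg_cst.
    by apply: cvgB; apply: cu.
  by apply/funext => n; rewrite /series /= /q -mulr_sumr sumrB.
have cvgq : h^-1 *: (limn (series (u ^~ (h *: 1 + 0))) - limn (series (u ^~ 0)))
    @[h --> 0^'] --> limn (series (u' ^~ 0)).
  apply/cvgrPdist_le => e e0.
  have e3 : 0 < e / 3 by rewrite divr_gt0.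
  have [N _ tailN] : \forall n \near \oo, limn (series M) - series M n <= e / 3.
    move/cvgrPdist_le : cM => /(_ _ e3); apply: filterS => n.
    exact: le_trans (ler_norm _).
  have {}tailN := tailN N (leqnn N).
  have dN : is_derive (0 : R) 1 (fun x => \sum_(k < N) u k x) (\sum_(k < N) u' k 0).
    rewrite (_ : (fun x => _) = \sum_(k < N) u k).
      by apply: is_derive_sum => k; exact: du.
    by apply/funext => x; rewrite fct_sumE.
  have /cvgrPdist_le /(_ _ e3) : h^-1 *: (\sum_(k < N) u k (h *: 1 + 0)
      - \sum_(k < N) u k 0) @[h --> 0^'] --> \sum_(k < N) u' k 0.
    rewrite -[X in _ --> X](@derive_val _ _ _ _ _ _ _ dN).
    exact: (@ex_derive _ _ _ _ _ _ _ dN).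
  have near_d : \forall h \near (0 : R)^', `|h| < d.
    by apply: dnbhs0_lt.
  have near_0 : \forall h \near (0 : R)^', h != 0 by exact: nbhs_dnbhs_neq.
  apply: filterS3 near_d near_0 => h hd h0.
  rewrite -[h *: 1]/(h * 1) mulr1 addr0 -[h^-1 *: _]/(h^-1 * _) => fin.
  rewrite -[h^-1 *: _]/(h^-1 * _) -q_lim//.
  have t1 := le_lim_series_tail N (u'M ^~ 0 ^~ normd0) cM.
  have t2 := le_lim_series_tail N (qM h ^~ h0 ^~ hd) cM.

  have e1 : series (q h) N = h^-1 * (\sum_(k < N) u k h - \sum_(k < N) u k 0).
    by rewrite /series /= /q -mulr_sumr sumrB !big_mkord.
  have e2 : series (u' ^~ 0) N = \sum_(k < N) u' k 0.
    by rewrite /series /= big_mkord.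
  rewrite -e1 -e2 in fin.
  move: t1 t2 fin tailN; rewrite !ler_norml => /andP[? ?] /andP[? ?] /andP[? ?] ?.
  by apply/andP; split; lra.
apply: DeriveDef; last exact: cvg_lim cvgq.
by apply/cvg_ex; exists (limn (series (u' ^~ 0))).
Qed.

End TermwiseDerivative.

(** * The instanton sums *)

Section InstantonSums.
Variable R : realType.
Implicit Types (w : nat -> R) (r th : R) (k : nat).

Definition cos_sum w th : R := limn (fun n => \sum_(1 <= k < n) cos (k%:R * th) * w k).
Definition sin_sum w th : R := limn (fun n => \sum_(1 <= k < n) sin (k%:R * th) * w k).

Lemma sum1_series (a : nat -> R) :
  limn (fun n => \sum_(1 <= k < n) a k) = limn (series (fun k => a k.+1)).
Proof.
rewrite /lim_in; congr (get _); apply/funext => l.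
rewrite -cvg_shiftS.
rewrite (_ : [sequence _]_n = series (fun k => a k.+1))//.
by apply/funext => n; rewrite /series /= big_add1.
Qed.

Lemma cos_sumN w th : cos_sum w (- th) = cos_sum w th.
Proof.
rewrite /cos_sum; do 2 f_equal; apply/funext => n; apply: eq_bigr => k _.
by rewrite mulrN cosN.
Qed.

Lemma sin_sumN w th : cvgn (series (fun k => sin (k.+1%:R * th) * w k.+1)) ->
  sin_sum w (- th) = - sin_sum w th.
Proof.
rewrite /sin_sum !sum1_series => /lim_seriesN <-.
congr (limn (series _)); apply/funext => n.
by rewrite mulrN sinN mulNr.
Qed.

Lemma cos_2pi_int (n : int) th : cos (th + 2 * pi * n%:~R) = cos th.
Proof.
have nat_case (m : nat) (x : R) : cos (x + 2 * pi * m%:R) = cos x.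
  have -> : 2 * pi * m%:R = pi *+ 2 *+ m :> R.
    by rewrite -[RHS]mulr_natr -[pi *+ 2]mulr_natr; ring.
  exact: (periodicn (@cosD2pi R)).
case: n => m; first exact: nat_case.
rewrite NegzE mulrNz -[LHS](nat_case m.+1).
have -> : th + 2 * pi * - (m.+1%:~R) + 2 * pi * m.+1%:R = th :> R.
  by rewrite -[m.+1%:~R]/(m.+1%:R); ring.
by [].
Qed.

Lemma sin_2pi_int (n : int) th : sin (th + 2 * pi * n%:~R) = sin th.
Proof.
have nat_case (m : nat) (x : R) : sin (x + 2 * pi * m%:R) = sin x.
  have -> : 2 * pi * m%:R = pi *+ 2 *+ m :> R.
    by rewrite -[RHS]mulr_natr -[pi *+ 2]mulr_natr; ring.
  exact: (periodicn (@sinD2pi R)).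
case: n => m; first exact: nat_case.
rewrite NegzE mulrNz -[LHS](nat_case m.+1).
have -> : th + 2 * pi * - (m.+1%:~R) + 2 * pi * m.+1%:R = th :> R.
  by rewrite -[m.+1%:~R]/(m.+1%:R); ring.
by [].
Qed.

Lemma cos_sum_periodic w th (n : int) : cos_sum w (th + 2 * pi * n%:~R) = cos_sum w th.
Proof.
rewrite /cos_sum; do 2 f_equal; apply/funext => N; apply: eq_bigr => k _.
rewrite mulrDr (_ : k%:R * (_ * _) = 2 * pi * (k%:Z * n)%:~R) ?cos_2pi_int//.
by rewrite intrM -[k%:Z%:~R]/(k%:R); ring.
Qed.

Lemma sin_sum_periodic w th (n : int) : sin_sum w (th + 2 * pi * n%:~R) = sin_sum w th.
Proof.
rewrite /sin_sum; do 2 f_equal; apply/funext => N; apply: eq_bigr => k _.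
rewrite mulrDr (_ : k%:R * (_ * _) = 2 * pi * (k%:Z * n)%:~R) ?sin_2pi_int//.
by rewrite intrM -[k%:Z%:~R]/(k%:R); ring.
Qed.

(** The coefficients of cis (k theta) in V^inst, A^inst and eta^inst, up to
    factors independent of k. *)
Definition K0_weight r k : R := besselK 0 (2 * pi * k%:R * r).
Definition K1_weight r k : R := r * besselK 1 (2 * pi * k%:R * r).
Definition eta_weight r k : R := K1_weight r k / k%:R.

Definition decay_ratio : R := expR (- 2^-1).

Lemma cvg_decay A : cvgn (series (geometric A decay_ratio)).
Proof.
apply: is_cvg_geometric_series.
by rewrite ger0_norm ?expR_ge0// expR_lt1 oppr_lt0.
Qed.

(** The exponential decay in k r splits into a factor decaying in r and a
    geometric factor in k, since pi k r >= k / 2 + r. *)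
Lemma moment_decay j r k : 2^-1 <= r ->
  cosh_moment j (2 * pi * k.+1%:R * r) <=
    expR (- r) * geometric (cosh_moment j 1) decay_ratio k.
Proof.
move=> r2; have p2 := @pi_ge2 R.
have k1 : 1 <= k.+1%:R :> R by rewrite ler1n.
have kr : 2^-1 <= k.+1%:R * r by nra.
apply: (le_trans (cosh_moment_decay j _)).
  by rewrite -mulrA; nra.
rewrite /geometric /= [leRHS]mulrCA -[leLHS]mulrC ler_wpM2l ?cosh_moment_ge0//.
rewrite /decay_ratio -expRM_natl -expRD ler_expR.
have -> : k.+1%:R = k%:R + 1 :> R by rewrite -natr1.
have k0 : 0 <= k%:R :> R by rewrite ler0n.
have : k%:R / 2 <= k%:R * r by rewrite ler_wpM2l.
have : 0 <= (k%:R + 1) * r by nra.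
by nra.
Qed.

Lemma norm_cos_le1 (x y : R) : `|cos x * y| <= `|y|.
Proof. by rewrite normrM ler_piMl// ler_norml cos_geN1 cos_le1. Qed.

Lemma norm_sin_le1 (x y : R) : `|sin x * y| <= `|y|.
Proof. by rewrite normrM ler_piMl// ler_norml sin_geN1 sin_le1. Qed.

Lemma expRN_le1 r : 0 <= r -> r * expR (- r) <= 1.
Proof.
move=> r0; rewrite expRN ler_pdivrMr ?expR_gt0// mul1r.
by apply: le_trans (expR_ge1Dx r); rewrite lerDr.
Qed.

Lemma K0_weight_le r k : 2^-1 <= r ->
  `|K0_weight r k.+1| <= geometric (cosh_moment 0 1 / r) decay_ratio k.
Proof.
move=> r2; have r0 : 0 < r by apply: lt_le_trans r2.
rewrite /K0_weight besselK0E ger0_norm ?cosh_moment_ge0//.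
apply: le_trans (moment_decay 0 k r2) _; rewrite /geometric /= mulrCA -!mulrA.
rewrite ler_wpM2l ?cosh_moment_ge0// [leRHS]mulrC [leRHS]mulrC.
rewrite ler_wpM2r ?exprn_ge0 ?expR_ge0//.
by rewrite -[leRHS]mul1r ler_pdivlMr// mulrC expRN_le1 ?(ltW r0).
Qed.

Lemma K1_weight_le r k : 2^-1 <= r ->
  `|K1_weight r k.+1| <= geometric (cosh_moment 1 1) decay_ratio k.
Proof.
move=> r2; have r0 : 0 < r by apply: lt_le_trans r2.
rewrite /K1_weight besselK1E ger0_norm ?mulr_ge0 ?cosh_moment_ge0 ?(ltW r0)//.
apply: (@le_trans _ _ (r * expR (- r) * geometric (cosh_moment 1 1) decay_ratio k)).
  by rewrite -[leRHS]mulrA ler_wpM2l ?(ltW r0)// moment_decay.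
rewrite ler_piMl ?expRN_le1 ?(ltW r0)//.
by rewrite mulr_ge0 ?cosh_moment_ge0// exprn_ge0// expR_ge0.
Qed.

Lemma eta_weight_le r k : 2^-1 <= r ->
  `|eta_weight r k.+1| <= geometric (cosh_moment 1 1) decay_ratio k.
Proof.
move=> r2; apply: le_trans (K1_weight_le k r2).
rewrite /eta_weight normrM ler_piMr// normfV invf_le1 ?normr_gt0//.
by rewrite ger0_norm// ler1n.
Qed.

Lemma cvg_trig (t : nat -> R) w A : (forall k, `|t k| <= `|w k.+1|) ->
  (forall k, `|w k.+1| <= geometric A decay_ratio k) -> cvgn (series t).
Proof.
move=> tw wA; apply: normed_cvg.
apply: (@series_le_cvg _ _ (geometric A (decay_ratio))) => [k|k|k|].
- exact: normr_ge0.
- exact: le_trans (normr_ge0 _) (wA k).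
- exact: le_trans (tw k) (wA k).
- exact: cvg_decay.
Qed.

Lemma cos_sum_le w A th : (forall k, `|w k.+1| <= geometric A decay_ratio k) ->
  `|cos_sum w th| <= A / (1 - decay_ratio).
Proof.
move=> wA; rewrite /cos_sum sum1_series.
have h k : `|cos (k.+1%:R * th) * w k.+1| <= geometric A decay_ratio k.
  exact: le_trans (norm_cos_le1 _ _) (wA k).
have := le_lim_series_tail 0 h (@cvg_decay A).
rewrite /series /= !big_nil !subr0.
rewrite (cvg_lim _ (@cvg_geometric_series _ A decay_ratio _))//.
by rewrite ger0_norm ?expR_ge0// expR_lt1 oppr_lt0.
Qed.

Lemma is_derive_affine (a b h : R) : is_derive h 1 (fun h : R => a + h * b) b.
Proof.
have := is_deriveD (is_derive_cst a h 1)
  (is_deriveM (is_derive_id h 1) (is_derive_cst b h 1)).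
by move=> /is_derive_eq; apply; rewrite /GRing.scale /=; ring.
Qed.

Lemma is_derive_eta_weight r k (vr h : R) : 0 < r + h * vr ->
  is_derive h 1 (fun h => eta_weight (r + h * vr) k.+1)
    (- (2 * pi * (r + h * vr) * vr * K0_weight (r + h * vr) k.+1)).
Proof.
move=> r0; have n0 : 0 < k.+1%:R :> R by rewrite ltr0n.
rewrite /eta_weight /K1_weight /K0_weight; move: (k.+1%:R : R) n0 => n n0.
have p0 : 0 < pi :> R by exact: pi_gt0.
have x0 : 0 < 2 * pi * n * (r + h * vr) by rewrite !mulr_gt0.
have d1 : is_derive h 1 (fun h => 2 * pi * n * (r + h * vr)) (2 * pi * n * vr).
  exact: (is_deriveZ (2 * pi * n) (is_derive_affine r vr h)).
have := is_deriveZ (2 * pi * n ^+ 2)^-1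
  (@is_derive1_comp R _ _ h _ _ (is_derive_xK1 x0) d1).
rewrite (_ : _ \*: _ =
    fun h => (r + h * vr) * besselK 1 (2 * pi * n * (r + h * vr)) / n).
  move=> /is_derive_eq; apply; rewrite besselK0E [LHS]/GRing.scale /=.
  by move: (pi : R) p0 => p p0; field; rewrite !gt_eqF.
apply/funext => y; rewrite besselK1E [LHS]/GRing.scale /=.
by move: (pi : R) p0 => p p0; field; rewrite !gt_eqF.
Qed.

(** On the weights r K_1(2 pi k r) / k the angular derivative gives the sine
    sum, and (x K_1)' = - x K_0 gives the radial one. *)
Lemma is_derive_cos_sum_eta_weight r th (vr vt : R) : 1 <= r ->
  is_derive (0 : R) 1 (fun h => cos_sum (eta_weight (r + h * vr)) (th + h * vt))
    (- (vt * sin_sum (K1_weight r) th) - 2 * pi * r * vr * cos_sum (K0_weight r) th).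
Proof.
move=> r1; pose q := decay_ratio.
pose u k h := cos (k.+1%:R * (th + h * vt)) * eta_weight (r + h * vr) k.+1.
pose u' k h := - (vt * (sin (k.+1%:R * (th + h * vt)) * K1_weight (r + h * vr) k.+1))
  - 2 * pi * (r + h * vr) * vr *
    (cos (k.+1%:R * (th + h * vt)) * K0_weight (r + h * vr) k.+1).
pose d : R := 2^-1 / (1 + `|vr|).
pose A := `|vt| * cosh_moment 1 1 + 2 * pi * `|vr| * cosh_moment 0 1.
have v0 : 0 < 1 + `|vr| by have := normr_ge0 vr; lra.
have d0 : 0 < d by rewrite divr_gt0.
have near_r h : `|h| < d -> 2^-1 <= r + h * vr.
  rewrite ltr_pdivlMr// => hd.
  have : `|h * vr| <= 2^-1.
    by rewrite normrM; have := normr_ge0 h; have := normr_ge0 vr; nra.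
  by rewrite ler_norml => /andP[? _]; lra.
have p0 : 0 < pi :> R by exact: pi_gt0.
have -> : (fun h => cos_sum (eta_weight (r + h * vr)) (th + h * vt)) =
    (fun h => limn (series (u ^~ h))).
  by apply/funext => h; rewrite /cos_sum sum1_series.
have cs : cvgn (series (fun k => sin (k.+1%:R * th) * K1_weight r k.+1)).
  apply: (cvg_trig (w := K1_weight r)) => [k|k]; first exact: norm_sin_le1.
  by apply: K1_weight_le; lra.
have cc : cvgn (series (fun k => cos (k.+1%:R * th) * K0_weight r k.+1)).
  apply: (cvg_trig (w := K0_weight r)) => [k|k]; first exact: norm_cos_le1.
  by apply: K0_weight_le; lra.
have -> : - (vt * sin_sum (K1_weight r) th) -
    2 * pi * r * vr * cos_sum (K0_weight r) th =
    limn (series (u' ^~ 0)).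
  rewrite /sin_sum /cos_sum !sum1_series; apply/esym/cvg_lim => //.
  rewrite (_ : series _ = fun n =>
    - (vt * series (fun k => sin (k.+1%:R * th) * K1_weight r k.+1) n) -
    2 * pi * r * vr * series (fun k => cos (k.+1%:R * th) * K0_weight r k.+1) n).
    by apply: cvgB; [apply: cvgN|]; apply: cvgM=> //; exact: cvg_cst.
  apply/funext => n; rewrite /series /= !mulr_sumr -sumrN -sumrB.
  by apply: eq_bigr => k _; rewrite /u' !mul0r !addr0.
apply: (is_derive_series (M := geometric A q) d0).
- move=> k h /near_r hr; have {hr} r0 : 0 < r + h * vr by lra.
  have dcos := @is_derive1_comp R cos _ h _ _ (is_derive_cos _)
    (is_deriveZ k.+1%:R (is_derive_affine th vt h)).
  have := is_deriveM dcos (is_derive_eta_weight k r0).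
  move=> /is_derive_eq; apply; rewrite /u' /eta_weight /GRing.scale /=.
  have : k.+1%:R != 0 :> R by rewrite pnatr_eq0.
  move: (k.+1%:R : R) (K1_weight _ _) (K0_weight _ _) (pi : R) => n a b p n0.
  by field.
- move=> k h /near_r hr; have r0 : 0 < r + h * vr by lra.
  have h1 : `|sin (k.+1%:R * (th + h * vt)) * K1_weight (r + h * vr) k.+1| <=
      cosh_moment 1 1 * q ^+ k.
    exact: le_trans (norm_sin_le1 _ _) (K1_weight_le k hr).
  have h2 : (r + h * vr) *
      `|cos (k.+1%:R * (th + h * vt)) * K0_weight (r + h * vr) k.+1| <=
      cosh_moment 0 1 * q ^+ k.
    have := le_trans (norm_cos_le1 (k.+1%:R * (th + h * vt)) _) (K0_weight_le k hr).
    rewrite -(ler_pM2l r0) => h2; apply: (le_trans h2).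
    by rewrite /geometric /= mulrA [_ * (_ / _)]mulrC divfK// gt_eqF.
  rewrite /u' (le_trans (ler_normB _ _))// normrN normrM.
  rewrite [X in _ + X](_ : _ = 2 * pi * `|vr| * ((r + h * vr) *
    `|cos (k.+1%:R * (th + h * vt)) * K0_weight (r + h * vr) k.+1|)).
    have -> : geometric A q k = `|vt| * (cosh_moment 1 1 * q ^+ k) +
        2 * pi * `|vr| * (cosh_moment 0 1 * q ^+ k).
      by rewrite -[LHS]/(A * q ^+ k) /A mulrDl !mulrA.
    apply: lerD; first by rewrite ler_wpM2l.
    by rewrite ler_wpM2l// !mulr_ge0// (ltW p0).
  rewrite [LHS]normrM [X in X * _]normrM [X in X * _ * _]normrM.
  rewrite (gtr0_norm r0) (@gtr0_norm _ (2 * pi)) ?mulr_gt0//; ring.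
- move=> h /near_r hr; apply: (cvg_trig (w := eta_weight (r + h * vr))) => [k|k].
    exact: norm_cos_le1.
  exact: eta_weight_le.
- exact: cvg_decay.
Qed.

End InstantonSums.
(** * The contributions of the charges gamma and - gamma *)

Import ComplexField.Normc.
Local Open Scope complex_scope.

Section Charges.
Variable R : realType.
Implicit Types (q u v : 'rV[R]_4) (x b : R).

Definition cx q : R := q 0 (@Ordinal 4 0 isT).
Definition cy q : R := q 0 (@Ordinal 4 1 isT).
Definition ca q : R := q 0 (@Ordinal 4 2 isT).
Definition cb q : R := q 0 (@Ordinal 4 3 isT).

Lemma zcE q : zc q = cx q +i* cy q. Proof. by []. Qed.

Lemma Z_dy q : Z gamma_dy q = zc q.
Proof. by rewrite /Z /= -[_ +i* _]/(1 : R[i]) mul1r. Qed.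

Lemma Z_Ndy q : Z (- gamma_dy) q = - zc q.
Proof.
rewrite /Z -[(- gamma_dy).1]/(0 : int) -[(- gamma_dy).2]/(-1 : int) mulrN1z mulr0z.
rewrite (_ : -1 +i* 0 = - 1 :> R[i]) ?mulN1r//.
by apply/eqP; rewrite eq_complex /= oppr0 !eqxx.
Qed.

Lemma Z_dx q : Z gamma_dx q = - cy q +i* cx q.
Proof.
by rewrite /Z zcE; apply/eqP; rewrite eq_complex /= !mul0r !mul1r !add0r !eqxx.
Qed.

Lemma theta_dx q : theta gamma_dx q = ca q.
Proof. by rewrite /theta /= mul0r mul1r addr0. Qed.

Lemma theta_dy q : theta gamma_dy q = cb q.
Proof. by rewrite /theta /= mul0r mul1r add0r. Qed.

Lemma theta_Ndy q : theta (- gamma_dy) q = - cb q.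
Proof.
rewrite /theta -[(- gamma_dy).1]/(0 : int) -[(- gamma_dy).2]/(-1 : int).
by rewrite mulrN1z mulr0z mul0r mulN1r add0r.
Qed.

Lemma sum_pos_cis (w : nat -> R) (t : R) :
  sum_pos (fun k => cis (k%:R * t) * (w k)%:C) = cos_sum w t +i* sin_sum w t.
Proof.
rewrite /sum_pos /cos_sum /sin_sum; apply/eqP; rewrite eq_complex /=; apply/andP; split;
  apply/eqP; do 2 f_equal; apply/funext => n; apply: eq_bigr => k _ /=;
  by rewrite mulr0 ?subr0 ?add0r.
Qed.

Lemma natC n : (n%:R : R[i]) = (n%:R)%:C.
Proof. by rewrite rmorph_nat. Qed.

Lemma intC (n : int) : (n%:~R : R[i]) = (n%:~R)%:C.
Proof. by rewrite rmorph_int. Qed.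

Lemma sum_pos_cisV r (t : R) :
  sum_pos (fun k => cis (k%:R * t) / k%:R * (r * besselK 1 (2 * pi * k%:R * r))%:C)
  = cos_sum (eta_weight r) t +i* sin_sum (eta_weight r) t.
Proof.
rewrite -sum_pos_cis; congr sum_pos; apply/funext => k.
rewrite /eta_weight /K1_weight; have -> y : (y / k%:R)%:C = k%:R^-1 * y%:C :> R[i].
  by rewrite mulrC rmorphM /= fmorphV natC.
by rewrite mulrA.
Qed.

Lemma normc_slice x : 0 <= x -> normc (x +i* 0) = x.
Proof. by move=> x0; rewrite /normc expr0n addr0 sqrtr_sqr ger0_norm. Qed.

Lemma normcN (z : R[i]) : normc (- z) = normc z.
Proof. by case: z => a b; rewrite /normc /= !sqrrN. Qed.

Lemma Vinst_dy q : Vinst gamma_dy q = ((2 * pi)^-1)%:C *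
  (cos_sum (K0_weight (normc (zc q))) (cb q)
   +i* sin_sum (K0_weight (normc (zc q))) (cb q)).
Proof. by rewrite /Vinst Z_dy theta_dy -sum_pos_cis. Qed.

Lemma Vinst_Ndy q : Vinst (- gamma_dy) q = ((2 * pi)^-1)%:C *
  (cos_sum (K0_weight (normc (zc q))) (cb q)
   +i* sin_sum (K0_weight (normc (zc q))) (- cb q)).
Proof. by rewrite /Vinst Z_Ndy theta_Ndy normcN -[in RHS]cos_sumN -sum_pos_cis. Qed.

Lemma dlogZ_dy q v : dlogZ gamma_dy q v = zc v / zc q - conjc (zc v) / conjc (zc q).
Proof. by rewrite /dlogZ /Zbar !Z_dy. Qed.

Lemma dlogZ_Ndy q v : dlogZ (- gamma_dy) q v = dlogZ gamma_dy q v.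
Proof.
by rewrite /dlogZ /Zbar !Z_dy !Z_Ndy !rmorphN /= !invrN !mulrNN.
Qed.

Lemma Ainst_dy q v : Ainst gamma_dy q v = - ((4 * pi)^-1)%:C *
  (cos_sum (K1_weight (normc (zc q))) (cb q)
   +i* sin_sum (K1_weight (normc (zc q))) (cb q)) *
  dlogZ gamma_dy q v.
Proof. by rewrite /Ainst Z_dy theta_dy -sum_pos_cis. Qed.

Lemma Ainst_Ndy q v : Ainst (- gamma_dy) q v = - ((4 * pi)^-1)%:C *
  (cos_sum (K1_weight (normc (zc q))) (cb q)
   +i* sin_sum (K1_weight (normc (zc q))) (- cb q)) *
  dlogZ gamma_dy q v.
Proof.
by rewrite /Ainst Z_Ndy theta_Ndy normcN dlogZ_Ndy -[in RHS]cos_sumN -sum_pos_cis.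
Qed.

Lemma etainst_dy q v : etainst_ gamma_dy q v = 'i%C * ((8 * pi ^+ 2)^-1)%:C *
  (cos_sum (eta_weight (normc (zc q))) (cb q)
   +i* sin_sum (eta_weight (normc (zc q))) (cb q)) *
  dlogZ gamma_dy q v.
Proof. by rewrite /etainst_ Z_dy theta_dy -sum_pos_cisV. Qed.

Lemma etainst_Ndy q v : etainst_ (- gamma_dy) q v = 'i%C * ((8 * pi ^+ 2)^-1)%:C *
  (cos_sum (eta_weight (normc (zc q))) (cb q)
   +i* sin_sum (eta_weight (normc (zc q))) (- cb q)) *
  dlogZ gamma_dy q v.
Proof.
by rewrite /etainst_ Z_Ndy theta_Ndy normcN dlogZ_Ndy -[in RHS]cos_sumN -sum_pos_cisV.
Qed.

End Charges.

(** * The Gibbons-Hawking metric on the slice *)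

Arguments cx {R} q.
Arguments cy {R} q.
Arguments ca {R} q.
Arguments cb {R} q.

Section SliceGeometry.
Variables (R : realType) (Omega : Lambda -> int) (m : int).
Hypotheses (Om : Omega gamma_dy = m) (OmN : Omega (- gamma_dy) = m).
Implicit Types (q u v : 'rV[R]_4) (x b : R).

Let M : R := m%:~R.

(** With dphi = d(Arg z^0), the metric g_N is the Gibbons-Hawking metric of
    potential [potential] and connection form dtheta_{d/dx^0} + [shift] dphi. *)
Definition potential x b : R := 1 + M / pi * cos_sum (K0_weight x) b.
Definition shift x b : R := 2 * M * sin_sum (K1_weight x) b.

(** What makes the imaginary parts of the contributions of gamma and - gamma
    cancel.  It needs convergence of the sums, unless they are multiplied by
    M = 0. *)
Definition parity x b : Prop :=
  M = 0 \/ (sin_sum (K0_weight x) (- b) = - sin_sum (K0_weight x) b /\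
            sin_sum (K1_weight x) (- b) = - sin_sum (K1_weight x) b).

Definition gh_connection q v : R := ca v + shift (cx q) (cb q) * (cy v / cx q).

Lemma dlogZ_slice q v : cy q = 0 -> 0 < cx q ->
  dlogZ gamma_dy q v = 0 +i* (2 * (cy v / cx q)).
Proof.
move=> y0 x0; rewrite dlogZ_dy !zcE y0 /= oppr0.
rewrite -[cx q +i* 0]/((cx q)%:C) -fmorphV /= /real_complex_def.
apply/eqP; rewrite eq_complex /=; apply/andP; split; apply/eqP; field;
  by rewrite gt_eqF.
Qed.

Lemma omega12_slice q u v : cy q = 0 -> 0 < cx q -> parity (cx q) (cb q) ->
  omega12 Omega q u v =
  ((2 * pi)^-1 * (wedge cx (gh_connection q) u v
                  + potential (cx q) (cb q) * wedge cy cb u v))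
  +i* ((2 * pi)^-1 *
       (wedge cy (gh_connection q) u v
        - potential (cx q) (cb q) * wedge cx cb u v)).
Proof.
move=> y0 x0 par.
rewrite /omega12 /support_charges !big_cons big_nil Om OmN /pair_wedge /wedge.
rewrite !Ainst_dy !Ainst_Ndy !Vinst_dy !Vinst_Ndy !dlogZ_slice// !Z_dx !Z_dy !Z_Ndy.
rewrite /thetaC !theta_dx !theta_dy !theta_Ndy !intC -!fmorphV.
rewrite !zcE y0 normc_slice ?ltW// -/M /gh_connection /potential /shift.
have p0 : 0 < pi :> R := pi_gt0 R.
have pN0 : pi != 0 :> R by rewrite gt_eqF.
have xN0 : cx q != 0 by rewrite gt_eqF.
move: (cos_sum (K0_weight _) _) (cos_sum (K1_weight _) _) par => P P1 par.
rewrite /real_complex_def.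
apply/eqP; rewrite eq_complex /=.
case: par => [->|[-> ->]]; apply/andP; split; apply/eqP;
  by move: (pi : R) pN0 => p pN0; field; rewrite ?pN0 ?xN0.
Qed.

Lemma omega3_slice q u v : cy q = 0 -> 0 < cx q -> parity (cx q) (cb q) ->
  omega3 Omega q u v = potential (cx q) (cb q) * wedge cx cy u v
  + ((2 * pi)^-1) ^+ 2 * wedge cb (gh_connection q) u v.
Proof.
move=> y0 x0 par.
rewrite /omega3 /omega3C /support_charges !big_cons big_nil Om OmN /pair_wedge /wedge.
rewrite !Ainst_dy !Ainst_Ndy !Vinst_dy !Vinst_Ndy !dlogZ_slice// /Zbar.
rewrite !Z_dx !Z_dy !Z_Ndy /thetaC !theta_dx !theta_dy !theta_Ndy !intC !natC -!fmorphV.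
rewrite !zcE y0 normc_slice ?ltW// -/M /gh_connection /potential /shift.
have p0 : 0 < pi :> R := pi_gt0 R.
have pN0 : pi != 0 :> R by rewrite gt_eqF.
have xN0 : cx q != 0 by rewrite gt_eqF.
move: (cos_sum (K0_weight _) _) (cos_sum (K1_weight _) _) par => P P1 par.
rewrite /real_complex_def /=.
by case: par => [->|[-> ->]]; move: (pi : R) pN0 => p pN0; field; rewrite ?pN0 ?xN0.
Qed.

Lemma ord4P (P : 'I_4 -> Prop) :
  P (@Ordinal 4 0 isT) -> P (@Ordinal 4 1 isT) ->
  P (@Ordinal 4 2 isT) -> P (@Ordinal 4 3 isT) -> forall i, P i.
Proof.
move=> P0 P1 P2 P3 [[|[|[|[|//]]]] hi]; by rewrite (bool_irrelevance hi isT).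
Qed.

Definition mx4 (l : seq (seq R)) : 'M[R]_4 := \matrix_(i, j) nth 0 (nth [::] l i) j.

Lemma sum4 (F : 'I_4 -> R) : \sum_i F i =
  F (@Ordinal 4 0 isT) + F (@Ordinal 4 1 isT) + F (@Ordinal 4 2 isT)
  + F (@Ordinal 4 3 isT).
Proof.
rewrite !big_ord_recl big_ord0 addr0 !addrA.
by congr (_ + _ + _ + _); congr (F _); apply/val_inj.
Qed.

Definition gibbons_hawking q u v : R :=
  potential (cx q) (cb q) *
    (cx u * cx v + cy u * cy v + ((2 * pi)^-1) ^+ 2 * (cb u * cb v))
  + ((2 * pi)^-1) ^+ 2 * (gh_connection q u * gh_connection q v)
    / potential (cx q) (cb q).

Lemma coord_delta (i : 'I_4) :
  [/\ cx (delta_mx 0 i : 'rV[R]_4) = (i == 0%N :> nat)%:R,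
      cy (delta_mx 0 i : 'rV[R]_4) = (i == 1%N :> nat)%:R,
      ca (delta_mx 0 i : 'rV[R]_4) = (i == 2%N :> nat)%:R
    & cb (delta_mx 0 i : 'rV[R]_4) = (i == 3%N :> nat)%:R].
Proof.
by split; rewrite /cx /cy /ca /cb mxE eqxx /= eq_sym.
Qed.

(** Only products and unit matrices are computed: once F2 and F3 are known to
    be invertible, the identities F2 K = G and - F3 K = F1 say that
    I_1 G = F1, whence g_N = I_1^-1 F1 = G. *)
Lemma gN_slice q u v : cy q = 0 -> 0 < cx q -> parity (cx q) (cb q) ->
  potential (cx q) (cb q) != 0 ->
  gN Omega q u v = gibbons_hawking q u v.
Proof.
move=> y0 x0 par; set W := potential _ _; move=> W0.
pose k : R := (2 * pi)^-1.
have k0 : k != 0 by rewrite invr_eq0 mulf_neq0 ?gt_eqF ?pi_gt0.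
pose g := shift (cx q) (cb q) / cx q.
have connE w : gh_connection q w = ca w + g * cy w by rewrite /gh_connection /g; ring.
pose F1 := mx4 [:: [:: 0; k * g; k; 0]; [:: - (k * g); 0; 0; k * W];
  [:: - k; 0; 0; 0]; [:: 0; - (k * W); 0; 0]].
pose F2 := mx4 [:: [:: 0; 0; 0; - (k * W)]; [:: 0; 0; k; 0];
  [:: 0; - k; 0; 0]; [:: k * W; 0; 0; 0]].
pose F3 := mx4 [:: [:: 0; W; 0; 0]; [:: - W; 0; 0; - (k ^+ 2 * g)];
  [:: 0; 0; 0; - k ^+ 2]; [:: 0; k ^+ 2 * g; k ^+ 2; 0]].
pose G := mx4 [:: [:: W; 0; 0; 0]; [:: 0; W + k ^+ 2 * g ^+ 2 / W; k ^+ 2 * g / W; 0];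
  [:: 0; k ^+ 2 * g / W; k ^+ 2 / W; 0]; [:: 0; 0; 0; k ^+ 2 * W]].
(* K is F2^-1 G, the matrix with F2 K = G and - F3 K = F1. *)
pose K := mx4 [:: [:: 0; 0; 0; k]; [:: 0; - (k * g / W); - (k / W); 0];
  [:: 0; W / k + k * g ^+ 2 / W; k * g / W; 0]; [:: - k^-1; 0; 0; 0]].
pose A2 := mx4 [:: [:: 0; 0; 0; (k * W)^-1]; [:: 0; 0; - k^-1; 0];
  [:: 0; k^-1; 0; 0]; [:: - (k * W)^-1; 0; 0; 0]].
pose A3 := mx4 [:: [:: 0; - W^-1; g / W; 0]; [:: W^-1; 0; 0; 0];
  [:: - (g / W); 0; 0; k ^- 2]; [:: 0; 0; - k ^- 2; 0]].
have E1 : form_mx (omega1 Omega q) = F1.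
  apply/matrixP => i j; rewrite !mxE /omega1 omega12_slice//= /wedge !connE -/W -/k.
  have [-> -> -> ->] := coord_delta i; have [-> -> -> ->] := coord_delta j.
  by move: i j; do 2 apply: ord4P => /=; ring.
have E2 : form_mx (omega2 Omega q) = F2.
  apply/matrixP => i j; rewrite !mxE /omega2 omega12_slice//= /wedge !connE -/W -/k.
  have [-> -> -> ->] := coord_delta i; have [-> -> -> ->] := coord_delta j.
  by move: i j; do 2 apply: ord4P => /=; ring.
have E3 : form_mx (omega3 Omega q) = F3.
  apply/matrixP => i j; rewrite !mxE omega3_slice//= /wedge !connE -/W -/k.
  have [-> -> -> ->] := coord_delta i; have [-> -> -> ->] := coord_delta j.
  by move: i j; do 2 apply: ord4P => /=; ring.
have eq_mx (A B : 'M[R]_4) : (forall i j, A i j = B i j) -> A = B by move/matrixP.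
have FA2 : F2 *m A2 = 1%:M.
  apply: eq_mx; do 2 apply: ord4P; rewrite mxE sum4 !mxE /=; field; rewrite ?W0 ?k0//.
have FA3 : F3 *m A3 = 1%:M.
  apply: eq_mx; do 2 apply: ord4P; rewrite mxE sum4 !mxE /=; field; rewrite ?W0 ?k0//.
have FK : F2 *m K = G.
  apply: eq_mx; do 2 apply: ord4P; rewrite mxE sum4 !mxE /=; field; rewrite ?W0 ?k0//.
have F3K : F3 *m K = - F1.
  apply: eq_mx; do 2 apply: ord4P; rewrite mxE sum4 !mxE /=; field; rewrite ?W0 ?k0//.
have [u2 _] := mulmx1_unit FA2.
have GE : invmx (I1_mx Omega q) *m form_mx (omega1 Omega q) = G.
  rewrite /I1_mx E1 E2 E3.
  have [uI _] : - (F3 *m invmx F2) \in unitmx /\ - (F2 *m A3) \in unitmx.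
    by apply: mulmx1_unit; rewrite mulNmx mulmxN opprK mulmxA mulmxKV.
  rewrite -[RHS](mulKmx uI) -FK mulNmx; congr (_ *m _).
  by rewrite mulmxA mulmxKV// F3K opprK.
rewrite /gN GE /gibbons_hawking !connE -/W -/k mxE sum4 !mxE !sum4 !mxE /=.
by rewrite /cx /cy /ca /cb; field; rewrite W0.
Qed.

(** The range where the instanton sums are controlled, or multiplied by 0.
    The case M = 0 has no lower bound on x, since the metric without
    instantons is considered on all of {rho > 0}. *)
Definition regular x : Prop := M = 0 \/ 1 <= x.

Lemma regular_parity x b : regular x -> parity x b.
Proof.
case=> [M0|x1]; [by left|right]; have x2 : 2^-1 <= x by lra.
split; apply: sin_sumN.
  apply: (cvg_trig (w := K0_weight x)) => k; [exact: norm_sin_le1|exact: K0_weight_le].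
apply: (cvg_trig (w := K1_weight x)) => k; [exact: norm_sin_le1|exact: K1_weight_le].
Qed.

Lemma Tform_potential q u v :
  Tform Omega q u v = potential (normc (zc q)) (cb q) * gM u v.
Proof.
rewrite /Tform /support_charges !big_cons big_nil Om OmN Vinst_dy Vinst_Ndy.
rewrite /gM /sqnorm_form !Z_dy !Z_Ndy /potential -/M !intC !zcE.
rewrite /real_complex_def /=.
have pN0 : pi != 0 :> R by rewrite gt_eqF ?pi_gt0.
by move: (pi : R) pN0 => p pN0; field.
Qed.

Definition f_polar (c x b : R) : R :=
  2 * pi * x ^+ 2 - c - 2 / pi * (M * cos_sum (eta_weight x) b).

(** The difference f - f_1, which is also pi g_N(X, X). *)
Definition gap x b : R :=
  4 * pi * x ^+ 2 * potential x b + shift x b ^+ 2 / (pi * potential x b).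

Lemma Vfield_coord q : cy q = 0 ->
  [/\ cx (Vfield q) = 0, cy (Vfield q) = cx q, ca (Vfield q) = 0
    & cb (Vfield q) = 0].
Proof.
move=> y0; rewrite /cx /cy /ca /cb /Vfield !mxE /=.
by rewrite -/(cy q) y0 oppr0.
Qed.

Lemma sum_etainst_slice q v : cy q = 0 -> 0 < cx q ->
  complex.Re (\sum_(g <- support_charges) (Omega g)%:~R * etainst_ g q v) =
  - (M * cos_sum (eta_weight (cx q)) (cb q) / (2 * pi ^+ 2) * (cy v / cx q)).
Proof.
move=> y0 x0.
rewrite /support_charges !big_cons big_nil Om OmN etainst_dy etainst_Ndy.
rewrite !dlogZ_slice// !intC !zcE y0 normc_slice ?ltW//.
rewrite /real_complex_def /= -/M.
have pN0 : pi != 0 :> R by rewrite gt_eqF ?pi_gt0.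
have xN0 : cx q != 0 by rewrite gt_eqF.
by move: (pi : R) pN0 => p pN0; field; rewrite ?pN0 ?xN0.
Qed.

Lemma f_slice c q : cy q = 0 -> 0 < cx q ->
  f Omega c q = f_polar c (cx q) (cb q).
Proof.
move=> y0 x0; rewrite /f sum_etainst_slice// zcE y0 normc_slice ?ltW//.
have [_ -> _ _] := Vfield_coord y0.
have pN0 : pi != 0 :> R by rewrite gt_eqF ?pi_gt0.
have xN0 : cx q != 0 by rewrite gt_eqF.
by rewrite /f_polar; move: (pi : R) pN0 => p pN0; field; rewrite ?pN0 ?xN0.
Qed.

Lemma etainst_slice q v : cy q = 0 -> 0 < cx q -> regular (cx q) ->
  potential (cx q) (cb q) != 0 ->
  etainst Omega q v =
  - (M * cos_sum (eta_weight (cx q)) (cb q) / (2 * pi ^+ 2) * (cy v / cx q))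
  - (gibbons_hawking q (Vfield q) v - cx q * cy v).
Proof.
move=> y0 x0 reg W0; rewrite /etainst sum_etainst_slice// gN_slice//; last first.
  exact: regular_parity.
rewrite /gM /sqnorm_form !zcE; have [-> -> _ _] := Vfield_coord y0.
by rewrite /= mul0r sub0r mulrN opprK.
Qed.

Lemma f1_slice c q : cy q = 0 -> 0 < cx q -> regular (cx q) ->
  potential (cx q) (cb q) != 0 ->
  f1 Omega c q = f_polar c (cx q) (cb q) - gap (cx q) (cb q).
Proof.
move=> y0 x0 reg W0; rewrite /f1 etainst_slice// zcE y0 normc_slice ?ltW//.
rewrite /gibbons_hawking /gh_connection; have [-> -> -> ->] := Vfield_coord y0.
rewrite /f_polar /gap.
have pN0 : pi != 0 :> R by rewrite gt_eqF ?pi_gt0.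
have xN0 : cx q != 0 by rewrite gt_eqF.
move: (potential _ _) W0 (pi : R) pN0 => W W0 p pN0.
by field; rewrite ?pN0 ?xN0 ?W0.
Qed.

(** A directional derivative only sees the function near the point along the
    line; here this allows the use of formulas valid on the slice only. *)
Lemma derive_along (V : normedModType R) (F : V -> R) (q v : V) (g : R -> R)
    (l : R) :
  (\forall h \near (0 : R), F (h *: v + q) = g h) -> is_derive (0 : R) 1 g l ->
  'D_v F q = l.
Proof.
move=> Fg dg.
have F0 : F q = g 0 by have := nbhs_singleton Fg; rewrite scale0r add0r.
apply: cvg_lim => //.
have cg : h^-1 *: (g (h *: 1 + 0) - g 0) @[h --> (0 : R)^'] --> l.
  rewrite -[X in _ --> X](@derive_val _ _ _ _ _ _ _ dg).
  exact: (@ex_derive _ _ _ _ _ _ _ dg).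
apply: cvg_trans cg; apply: near_eq_cvg; apply: nbhs_dnbhs.
apply: filterS Fg => h /= ->.
by rewrite F0 addr0 -[h *: 1]/(h * 1) mulr1.
Qed.

(** The radial derivative of the cosine sum in f is a multiple of W - 1 and its
    angular derivative is a multiple of the sine sum: f is the moment map of
    X for 2 pi omega_3. *)
Lemma derive_f c q v : cy q = 0 -> 0 < cx q -> regular (cx q) -> cy v = 0 ->
  'D_v (f Omega c) q =
  4 * pi * cx q * potential (cx q) (cb q) * cx v + shift (cx q) (cb q) / pi * cb v.
Proof.
move=> y0 x0 reg v0.
apply: (derive_along (g := fun h => f_polar c (cx q + h * cx v) (cb q + h * cb v))).
  have : \forall h \near (0 : R), 0 < cx q + h * cx v.
    have cvg0 : cx q + h * cx v @[h --> (0:R)] --> cx q + 0 * cx v.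
      apply: cvgD; first exact: cvg_cst.
      by apply: cvgM; [exact: cvg_id|exact: cvg_cst].
    by apply: (cvgr_gt _ cvg0); rewrite mul0r addr0.
  apply: filterS => h h0.
  have E i : (h *: v + q) 0 i = q 0 i + h * v 0 i by rewrite !mxE addrC.
  by rewrite f_slice /cx /cy /cb !E // -/(cy q) -/(cy v) y0 v0 mulr0 addr0.
rewrite /f_polar.
have dsq := is_deriveM (is_derive_affine (cx q) (cx v) 0)
  (is_derive_affine (cx q) (cx v) 0).
have dC : is_derive (0 : R) 1
    (fun h => M * cos_sum (eta_weight (cx q + h * cx v)) (cb q + h * cb v))
    (M * (- (cb v * sin_sum (K1_weight (cx q)) (cb q))
          - 2 * pi * cx q * cx v * cos_sum (K0_weight (cx q)) (cb q))).
  case: reg => [M0|x1].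
    rewrite M0 mul0r; under eq_fun do rewrite mul0r; exact: is_derive_cst.
  exact: (is_deriveZ M (is_derive_cos_sum_eta_weight (cb q) (cx v) (cb v) x1)).
have := is_deriveB (is_deriveB (is_deriveZ (2 * pi) dsq) (is_derive_cst c (0 : R) 1))
  (is_deriveZ (2 / pi) dC).
rewrite (_ : (_ - _)%R = fun h => 2 * pi * (cx q + h * cx v) ^+ 2 - c -
    2 / pi * (M * cos_sum (eta_weight (cx q + h * cx v)) (cb q + h * cb v))).
  move=> /is_derive_eq; apply; rewrite /potential /shift -/M /GRing.scale /= mul0r addr0.
  have pN0 : pi != 0 :> R by rewrite gt_eqF ?pi_gt0.
  by move: (pi : R) pN0 => p pN0; field.
by apply/funext => h; rewrite expr2.
Qed.

End SliceGeometry.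

(** * The quaternionic-Kaehler metric on the slice *)

Section Algebra.
Variable R : realType.

(** The value of g_{overline N} on two vectors tangent to the slice; X, A, B
    are the components of a vector along Re z^0, theta_{d/dx^0},
    theta_{d/dy_0}, and D is its value under dsigma - <theta, dtheta> / 4 pi. *)
Definition qk_form (f f1 W s x X A B D X' A' B' D' : R) : R :=
  - f^-1 *
  (2 / f1 * ((D - s / (2 * pi * W) * A) * (D' - s / (2 * pi * W) * A'))
   + 2 * pi * (W * (X * X' + ((2 * pi)^-1) ^+ 2 * (B * B'))
               + ((2 * pi)^-1) ^+ 2 * (A * A') / W)
   - 2 / f * ((2 * pi * x * W * X + s / (2 * pi) * B)
              * (2 * pi * x * W * X' + s / (2 * pi) * B')
              + D * D' + x * A * (x * A')
              + (s * X - x * W * B) * (s * X' - x * W * B'))).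

(** The cross terms in X B cancel.  With h = f - f_1, the part in (X, B) is
    - 2 pi W f_1 / f^2 (X^2 + (B / 2 pi)^2), and the part in (D, A) has
    discriminant - 16 x^2 / f^4, by the formula for f - f_1. *)
Lemma qk_form_gt0 (f f1 W s x X A B D : R) : 0 < x -> 0 < W -> 0 < f -> f1 < 0 ->
  f - f1 = 4 * pi * x ^+ 2 * W + s ^+ 2 / (pi * W) ->
  [|| X != 0, A != 0, B != 0 | D != 0] ->
  0 < qk_form f f1 W s x X A B D X A B D.
Proof.
move=> x0 W0 f0 f10 gapE nz.
have p0 : 0 < pi :> R := pi_gt0 R.
pose h := f - f1.
have h0 : 0 < h by rewrite /h; lra.
have E : qk_form f f1 W s x X A B D X A B D =
    2 * pi * W * (- f1) / f ^+ 2 * (X ^+ 2 + (B / (2 * pi)) ^+ 2)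
  + 2 / (h * f ^+ 2 * (- f1)) *
      ((h * D - s / (2 * pi * W) * f * A) ^+ 2 + (x * f1 * A) ^+ 2).
  have f1E : f1 = f - (4 * pi * x ^+ 2 * W + s ^+ 2 / (pi * W)) by lra.
  have hE : h = 4 * pi * x ^+ 2 * W + s ^+ 2 / (pi * W) by rewrite /h gapE.
  rewrite hE /qk_form.
  have hN : 4 * pi * x ^+ 2 * W + s ^+ 2 / (pi * W) != 0 by rewrite -hE gt_eqF.
  have f1N : f - (4 * pi * x ^+ 2 * W + s ^+ 2 / (pi * W)) != 0.
    by rewrite -f1E lt_eqF.
  rewrite f1E; move: (pi : R) p0 hN f1N => p p0 hN f1N.
  have pW : p * W != 0 by rewrite gt_eqF ?mulr_gt0.
  have gapM : 4 * p * x ^+ 2 * W * (p * W) + s ^+ 2 =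
      (4 * p * x ^+ 2 * W + s ^+ 2 / (p * W)) * (p * W).
    by rewrite [RHS]mulrDl divfK.
  have n1 := mulf_neq0 hN pW; have n2 := mulf_neq0 f1N pW.
  by field; rewrite gapM -mulrBl n1 n2 !gt_eqF.
rewrite E.
have c1 : 0 < 2 * pi * W * (- f1) / f ^+ 2.
  by rewrite divr_gt0 ?exprn_gt0// !mulr_gt0// oppr_gt0.
have c2 : 0 < 2 / (h * f ^+ 2 * (- f1)).
  by rewrite divr_gt0// !mulr_gt0 ?exprn_gt0// oppr_gt0.
have sq (y : R) : y != 0 -> 0 < y ^+ 2 by move=> y0; rewrite exprn_even_gt0.
have q1 : 0 <= X ^+ 2 + (B / (2 * pi)) ^+ 2 by rewrite addr_ge0 ?sqr_ge0.
set u := h * D - _; have q2 : 0 <= u ^+ 2 + (x * f1 * A) ^+ 2.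
  by rewrite addr_ge0 ?sqr_ge0.
have g1 : 0 <= 2 * pi * W * (- f1) / f ^+ 2 * (X ^+ 2 + (B / (2 * pi)) ^+ 2).
  by apply: mulr_ge0 => //; exact: ltW.
have g2 : 0 <= 2 / (h * f ^+ 2 * (- f1)) * (u ^+ 2 + (x * f1 * A) ^+ 2).
  by apply: mulr_ge0 => //; exact: ltW.
have [/andP[X0 B0]|XB] := boolP ((X == 0) && (B == 0)); last first.
  apply: ltr_pwDl => //; apply: mulr_gt0 => //.
  move: XB; rewrite negb_and => /orP[X0|B0].
    by apply: ltr_pwDl; [exact: sq|exact: sqr_ge0].
  apply: ltr_wpDl; [exact: sqr_ge0|apply: sq].
  by rewrite mulf_neq0// invr_eq0 gt_eqF ?mulr_gt0.
apply: ltr_wpDl => //; apply: mulr_gt0 => //.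
have [A0|A0] := eqVneq A 0; last first.
  apply: ltr_wpDl; [exact: sqr_ge0|apply: sq].
  by rewrite !mulf_neq0// ?(lt_eqF f10)// gt_eqF.
apply: ltr_pwDl; [apply: sq|exact: sqr_ge0].
move: nz; rewrite X0 B0 A0 eqxx /= => D0.
by rewrite /u A0 mulr0 subr0 mulf_neq0// gt_eqF.
Qed.

End Algebra.

Section SliceMetric.
Variables (R : realType) (Omega : Lambda -> int) (m : int).
Hypotheses (Om : Omega gamma_dy = m) (OmN : Omega (- gamma_dy) = m).
Implicit Types (p u v : 'rV[R]_(4 + 1)).

Lemma slice_coord p : slice p -> 0 < cx (prN p) /\ cy (prN p) = 0.
Proof. by []. Qed.

Lemma Xfield_coord (q : 'rV[R]_4) : cy q = 0 ->
  [/\ cx (Xfield q) = 0, cy (Xfield q) = 2 * cx q, ca (Xfield q) = 0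
    & cb (Xfield q) = 0].
Proof.
move=> y0; have [hx hy ha hb] := Vfield_coord y0.
have E i : Xfield q 0 i = 2 * Vfield q 0 i by rewrite mxE.
split; rewrite [LHS]E; [rewrite [X in _ * X]hx|rewrite [X in _ * X]hy|
  rewrite [X in _ * X]ha|rewrite [X in _ * X]hb]; by rewrite ?mulr0.
Qed.

Lemma gN_X (q v : 'rV[R]_4) : cy q = 0 -> 0 < cx q -> regular m (cx q) ->
  potential m (cx q) (cb q) != 0 -> cy v = 0 ->
  gN Omega q (Xfield q) v =
  2 * ((2 * pi)^-1 ^+ 2 * shift m (cx q) (cb q) * ca v / potential m (cx q) (cb q)).
Proof.
move=> y0 x0 reg W0 v0.
rewrite (gN_slice Om OmN)//; last exact: regular_parity.
rewrite /gibbons_hawking /gh_connection; have [-> -> -> ->] := Xfield_coord y0.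
have pN0 : pi != 0 :> R by rewrite gt_eqF ?pi_gt0.
have xN0 : cx q != 0 by rewrite gt_eqF.
move: (potential _ _ _) W0 (pi : R) pN0 => W W0 P pN0.
by rewrite v0; field; rewrite ?pN0 ?xN0 ?W0.
Qed.

Lemma eta_slice p v : slice p -> slice_tangent v -> regular m (cx (prN p)) ->
  potential m (cx (prN p)) (cb (prN p)) != 0 ->
  eta Omega p v = dsigma_theta p v - shift m (cx (prN p)) (cb (prN p)) /
    (2 * pi * potential m (cx (prN p)) (cb (prN p))) * ca (prN v).
Proof.
move=> /slice_coord[x0 y0] v0 reg W0; rewrite /eta /r2eta /gM /sqnorm_form !zcE.
rewrite (etainst_slice Om OmN)// /gibbons_hawking /gh_connection.
have [-> -> -> ->] := Vfield_coord y0.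
rewrite -[cy (prN v)]/(complex.Im (zc (prN v))) v0 /=.
have pN0 : pi != 0 :> R by rewrite gt_eqF ?pi_gt0.
have xN0 : cx (prN p) != 0 by rewrite gt_eqF.
move: (potential _ _ _) W0 (pi : R) pN0 => W W0 P pN0.
by field; rewrite ?pN0 ?xN0 ?W0.
Qed.

(** The instanton term of eta and iota_X g_N / 2 are opposite. *)
Lemma thetaP1_slice p v : slice p -> slice_tangent v -> regular m (cx (prN p)) ->
  potential m (cx (prN p)) (cb (prN p)) != 0 ->
  thetaP1 Omega p v = dsigma_theta p v.
Proof.
move=> sp v0 reg W0; have [x0 y0] := slice_coord sp.
rewrite /thetaP1 eta_slice// gN_X//.
have pN0 : pi != 0 :> R by rewrite gt_eqF ?pi_gt0.
move: (potential _ _ _) W0 (pi : R) pN0 => W W0 P pN0.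
by field; rewrite ?pN0 ?W0.
Qed.

Lemma thetaP2_slice p v : slice p -> slice_tangent v -> regular m (cx (prN p)) ->
  thetaP2 Omega p v = cx (prN p) * ca (prN v).
Proof.
move=> /slice_coord[x0 y0] v0 reg; rewrite /thetaP2 /omega2.
rewrite (omega12_slice Om OmN)//; last exact: regular_parity.
rewrite /wedge /gh_connection /=; have [-> -> -> ->] := Xfield_coord y0.
rewrite -[cy (prN v)]/(complex.Im (zc (prN v))) v0.
have pN0 : pi != 0 :> R by rewrite gt_eqF ?pi_gt0.
have xN0 : cx (prN p) != 0 by rewrite gt_eqF.
by move: (pi : R) pN0 => P pN0; field; rewrite ?pN0 ?xN0.
Qed.

Lemma thetaP3_slice p v : slice p -> slice_tangent v -> regular m (cx (prN p)) ->
  thetaP3 Omega p v = shift m (cx (prN p)) (cb (prN p)) * cx (prN v)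
    - cx (prN p) * potential m (cx (prN p)) (cb (prN p)) * cb (prN v).
Proof.
move=> /slice_coord[x0 y0] v0 reg; rewrite /thetaP3 /omega1.
rewrite (omega12_slice Om OmN)//; last exact: regular_parity.
rewrite /wedge /gh_connection /=; have [-> -> -> ->] := Xfield_coord y0.
rewrite -[cy (prN v)]/(complex.Im (zc (prN v))) v0.
have pN0 : pi != 0 :> R by rewrite gt_eqF ?pi_gt0.
have xN0 : cx (prN p) != 0 by rewrite gt_eqF.
by move: (pi : R) pN0 => P pN0; field; rewrite ?pN0 ?xN0.
Qed.

Lemma gNbar_slice c p u v :
  slice p -> slice_tangent u -> slice_tangent v -> regular m (cx (prN p)) ->
  potential m (cx (prN p)) (cb (prN p)) != 0 ->
  gNbar Omega c p u v =
  qk_form (f_polar m c (cx (prN p)) (cb (prN p)))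
    (f_polar m c (cx (prN p)) (cb (prN p)) - gap m (cx (prN p)) (cb (prN p)))
    (potential m (cx (prN p)) (cb (prN p))) (shift m (cx (prN p)) (cb (prN p)))
    (cx (prN p))
    (cx (prN u)) (ca (prN u)) (cb (prN u)) (dsigma_theta p u)
    (cx (prN v)) (ca (prN v)) (cb (prN v)) (dsigma_theta p v).
Proof.
move=> sp u0 v0 reg W0; have [x0 y0] := slice_coord sp.
rewrite /gNbar /gP (f1_slice Om OmN)// (f_slice Om OmN)//.
rewrite !eta_slice// !thetaP1_slice// !thetaP2_slice// !thetaP3_slice//.
rewrite /thetaP0 !(derive_f Om OmN)//.
rewrite (gN_slice Om OmN)//; last exact: regular_parity.
rewrite /gibbons_hawking /gh_connection /qk_form.
rewrite -[cy (prN v)]/(complex.Im (zc (prN v))) v0.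
rewrite -[cy (prN u)]/(complex.Im (zc (prN u))) u0.
move: (f_polar _ _ _ _) (gap _ _ _) => F H.
have pN0 : pi != 0 :> R by rewrite gt_eqF ?pi_gt0.
rewrite !mul0r !mulr0 !addr0; congr (- _ * (_ - _ * _)).
move: (pi : R) pN0 => P pN0.
by field.
Qed.

End SliceMetric.

(** * Invariance under the Heisenberg group *)

Section Heisenberg.
Variable R : realType.
Implicit Types (p u v : 'rV[R]_(4 + 1)) (d : Lambda) (k : int).

Lemma derive_affine (V W : normedModType R) (F : V -> W) (q v : V) (L : W) :
  (forall h : R, F (h *: v + q) = h *: L + F q) -> 'D_v F q = L.
Proof.
move=> FL; apply: cvg_lim => //.
have c0 : (fun=> L) h @[h --> (0 : R)^'] --> L by exact: cvg_cst.
apply: cvg_trans c0; apply: near_eq_cvg.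
have near0 : \forall h \near (0 : R)^', h != 0 by exact: nbhs_dnbhs_neq.
apply: filterS near0 => h h0 /=.
by rewrite FL addrK scalerA mulVf// scale1r.
Qed.

Definition dheis d v : 'rV[R]_(4 + 1) :=
  row_mx (prN v) (sigma v + 2^-1 * pairing d (prN v))%:M.

Lemma pairingD d (a : R) (q q' : 'rV[R]_4) :
  pairing d (a *: q + q') = a * pairing d q + pairing d q'.
Proof. by rewrite /pairing !theta_dx !theta_dy /ca /cb !mxE; ring. Qed.

Lemma derive_heis d k p v : 'D_v (heis d k) p = dheis d v.
Proof.
apply: derive_affine => h; rewrite /heis /dheis.
rewrite scale_row_mx add_row_mx; congr row_mx.
  by rewrite /prN linearP -addrA.
rewrite scale_scalar_mx -raddfD /=; congr (_%:M).
have -> : prN (h *: v + p) = h *: prN v + prN p by rewrite /prN linearP.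
have -> : sigma (h *: v + p) = h * sigma v + sigma p by rewrite /sigma linearP !mxE.
by rewrite pairingD; ring.
Qed.

Lemma prN_dheis d v : prN (dheis d v) = prN v.
Proof. by rewrite /prN /dheis row_mxKl. Qed.

Lemma heis_coord d k p :
  [/\ cx (prN (heis d k p)) = cx (prN p), cy (prN (heis d k p)) = cy (prN p),
      ca (prN (heis d k p)) = ca (prN p) + 2 * pi * d.1%:~R
    & cb (prN (heis d k p)) = cb (prN p) + 2 * pi * d.2%:~R].
Proof.
by rewrite /heis /prN row_mxKl /cx /cy /ca /cb !mxE /= !addr0.
Qed.

Lemma slice_heis d k p : slice p -> slice (heis d k p).
Proof.
have [hx hy _ _] := heis_coord d k p.
by move=> [x0 y0]; split; [rewrite -[complex.Re _]/(cx _) hx|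
  rewrite -[complex.Im _]/(cy _) hy].
Qed.

(** The contact form dsigma - <theta, dtheta> / 4 pi is what the Heisenberg
    action is designed to preserve. *)
Lemma dsigma_theta_heis d k p v :
  dsigma_theta (heis d k p) (dheis d v) = dsigma_theta p v.
Proof.
rewrite /dsigma_theta prN_dheis !theta_dx !theta_dy.
have [_ _ -> ->] := heis_coord d k p.
rewrite {1}/sigma /dheis row_mxKr mxE eqxx mulr1n /pairing !theta_dx !theta_dy.
have pN0 : pi != 0 :> R by rewrite gt_eqF ?pi_gt0.
by move: (pi : R) pN0 => P pN0; field.
Qed.

Lemma dsigma_thetaP p a u v :
  dsigma_theta p (a *: u + v) = a * dsigma_theta p u + dsigma_theta p v.
Proof.
rewrite /dsigma_theta !theta_dx !theta_dy.
have -> : prN (a *: u + v) = a *: prN u + prN v by rewrite /prN linearP.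
have -> : sigma (a *: u + v) = a * sigma u + sigma v by rewrite /sigma linearP !mxE.
by rewrite /ca /cb !mxE; ring.
Qed.

Lemma rhoE c p : slice p -> rho c p = 2 * pi * cx (prN p) ^+ 2 - c.
Proof.
by move=> [x0 y0]; rewrite /rho zcE [cy _]y0 normc_slice// ltW.
Qed.

Lemma rho_heis c d k p : rho c (heis d k p) = rho c p.
Proof. by rewrite /rho !zcE; have [-> -> _ _] := heis_coord d k p. Qed.

Lemma projP_eq p p' : projP p = projP p' -> exists d k, p' = heis d k p.
Proof. by move=> /eqquotP /asboolP. Qed.

Lemma prN_coord p v : cy (prN v) = 0 -> cx (prN v) = 0 -> ca (prN v) = 0 ->
  cb (prN v) = 0 -> dsigma_theta p v = 0 -> v = 0.
Proof.
move=> y0 x0 a0 b0; rewrite /dsigma_theta !theta_dx !theta_dy a0 b0 !mulr0 subrr.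
rewrite mulr0 subr0 => s0; rewrite -[LHS]hsubmxK.
have -> : lsubmx v = 0.
  apply/rowP => i; rewrite [RHS]mxE -/(prN v); move: i.
  exact: ord4P.
have -> : rsubmx v = 0.
  by apply/rowP => i; rewrite ord1 [RHS]mxE; exact: s0.
by rewrite row_mx0.
Qed.

Definition on_slice_qk (F F1 W s : R) (p u v : 'rV[R]_(4 + 1)) : R :=
  qk_form F F1 W s (cx (prN p))
    (cx (prN u)) (ca (prN u)) (cb (prN u)) (dsigma_theta p u)
    (cx (prN v)) (ca (prN v)) (cb (prN v)) (dsigma_theta p v).

Lemma on_slice_qk_heis F F1 W s d k p u v :
  on_slice_qk F F1 W s (heis d k p) (dheis d u) (dheis d v) =
  on_slice_qk F F1 W s p u v.
Proof.
rewrite /on_slice_qk !prN_dheis !dsigma_theta_heis.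
by have [-> _ _ _] := heis_coord d k p.
Qed.

(** Both g_{overline N} and g_FS^c have this shape along the slice, with
    different parameters. *)
Lemma inner_product_on_slice g (F F1 W s : R) p : slice p ->
  (forall u v, slice_tangent u -> slice_tangent v ->
    g u v = on_slice_qk F F1 W s p u v) ->
  0 < W -> 0 < F -> F1 < 0 ->
  F - F1 = 4 * pi * cx (prN p) ^+ 2 * W + s ^+ 2 / (pi * W) ->
  inner_product_on (@slice_tangent R) g.
Proof.
move=> [x0 y0] gE W0 F0 F10 gapE.
have tan a (u v : 'rV[R]_(4 + 1)) :
    slice_tangent u -> slice_tangent v -> slice_tangent (a *: u + v).
  have E : cy (prN (a *: u + v)) = a * cy (prN u) + cy (prN v).
    by rewrite /prN linearP /cy !mxE.
  move=> u0 v0; rewrite /slice_tangent /= -[LHS]/(cy (prN (a *: u + v))) E.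
  by rewrite [cy (prN u)]u0 [cy (prN v)]v0 mulr0 addr0.
split.
- move=> a u v w Tu Tv Tw; rewrite !gE//; last exact: tan.
  rewrite /on_slice_qk dsigma_thetaP.
  have -> : prN (a *: u + v) = a *: prN u + prN v by rewrite /prN linearP.
  by rewrite /qk_form /cx /ca /cb !mxE; ring.
- by move=> u v Tu Tv; rewrite !gE// /on_slice_qk /qk_form; ring.
- move=> u Tu u0; rewrite gE// /on_slice_qk; apply: qk_form_gt0 => //.
  apply: contraNT u0; rewrite !negb_or !negbK.
  move=> /and4P[/eqP X0 /eqP A0 /eqP B0 /eqP D0].
  by apply/eqP; exact: prN_coord Tu X0 A0 B0 D0.
Qed.

End Heisenberg.

(** * The metric of the universal hypermultiplet *)

Section FubiniStudy.
Variables (R : realType) (c : R).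
Hypothesis c0 : 0 <= c.
Implicit Types (p u v : 'rV[R]_(4 + 1)).

Lemma derive_rho p v : slice p -> slice_tangent v ->
  'D_v (rho c) p = 4 * pi * cx (prN p) * cx (prN v).
Proof.
move=> [x0 y0] v0.
pose g (h : R) := 2 * pi * (cx (prN p) + h * cx (prN v)) ^+ 2 - c.
have rho_g : \forall h \near (0 : R), rho c (h *: v + p) = g h.
  exists 1 => //= h _; rewrite /rho /g.
  have -> : prN (h *: v + p) = h *: prN v + prN p by rewrite /prN linearP.
  have -> : zc (h *: prN v + prN p) = (cx (prN p) + h * cx (prN v)) +i* 0.
    have E i : (h *: prN v + prN p) 0 i = prN p 0 i + h * prN v 0 i.
      by rewrite !mxE addrC.
    rewrite zcE {1}/cy E -!/(cy _) [cy (prN p)]y0 [cy (prN v)]v0 mulr0 addr0.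
    by rewrite {1}/cx E.
  by rewrite /normc expr0n addr0 sqr_sqrtr// sqr_ge0.
apply: (derive_along rho_g).
have dsq := is_deriveM (is_derive_affine (cx (prN p)) (cx (prN v)) 0)
  (is_derive_affine (cx (prN p)) (cx (prN v)) 0).
have := is_deriveB (is_deriveZ (2 * pi) dsq) (is_derive_cst c (0 : R) 1).
by move=> /is_derive_eq; apply; rewrite /GRing.scale /= mul0r addr0; ring.
Qed.

(** Without instantons the Gibbons-Hawking potential is 1 and the connection
    is flat. *)
Lemma gFS_slice p u v : slice p -> 0 < rho c p ->
  slice_tangent u -> slice_tangent v ->
  gFS c p u v = on_slice_qk (rho c p) (- (rho c p + 2 * c)) 1 0 p u v.
Proof.
move=> sp r0 u0 v0; rewrite /gFS !derive_rho//.
have [x0 y0] := sp.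
rewrite /sqnorm_form /W0 !theta_dx !theta_dy /=.
rewrite /on_slice_qk /qk_form.
rewrite -/(cx _) in x0 *.
have xN0 : cx (prN p) != 0 by rewrite gt_eqF.
have pN0 : pi != 0 :> R by rewrite gt_eqF ?pi_gt0.
have rN0 : rho c p != 0 by rewrite gt_eqF.
have r2N0 : rho c p + 2 * c != 0 by rewrite gt_eqF// ltr_pwDl// mulr_ge0.
have rE : c = 2 * pi * cx (prN p) ^+ 2 - rho c p by rewrite rhoE//; ring.
move: (rho c p) rE rN0 r2N0 => r rE; rewrite rE.
move: (cx (prN p)) (pi : R) xN0 pN0 => x P xN0 pN0 rN0 r2N0.
have r3N0 : r + (2 * P * x ^+ 2 - r) != 0.
  by rewrite addrC subrK !mulf_neq0 ?expf_neq0// pnatr_eq0.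
by field; rewrite ?xN0 ?pN0 ?rN0 ?r2N0 ?r3N0.
Qed.

End FubiniStudy.

(** * The end rho -> oo *)

Section NearInfinity.
Variables (R : realType) (Omega : Lambda -> int) (m : int) (c : R).
Hypotheses (Om : Omega gamma_dy = m) (OmN : Omega (- gamma_dy) = m).
Hypothesis c0 : 0 <= c.

Let M : R := m%:~R.
Let B0 : R := cosh_moment 0 1 / (1 - decay_ratio R).
Let B1 : R := cosh_moment 1 1 / (1 - decay_ratio R).

(** Beyond this radius 2 |M| B0 <= x forces |W - 1| <= 1 / 4, and
    c + |M| B1 < x keeps f and f_1 at their leading signs. *)
Definition radius : R := 1 + c + 2 * `|M| * B0 + `|M| * B1.

Let B_ge0 : 0 <= B0 /\ 0 <= B1.
Proof.
have q1 : 0 <= 1 - decay_ratio R.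
  by rewrite subr_ge0 ltW// expR_lt1 oppr_lt0.
by split; rewrite mulr_ge0 ?cosh_moment_ge0 ?invr_ge0.
Qed.

Lemma radius_ge1 : 1 <= radius.
Proof.
have [b0 b1] := B_ge0; rewrite /radius.
have := mulr_ge0 (normr_ge0 M) b0; have := mulr_ge0 (normr_ge0 M) b1.
move: (`|M|) B0 B1 c0 => N x y z h1 h2; rewrite -(mulrA 2); lra.
Qed.

Lemma instanton_bounds x b : radius <= x ->
  [/\ 3 / 4 <= potential m x b, 0 < f_polar m c x b
    & f_polar m c x b - gap m x b < 0].
Proof.
move=> xr; have [b0 b1] := B_ge0; have r1 := radius_ge1.
have x1 : 1 <= x by exact: le_trans xr.
have x0 : 0 < x by lra.
have p2 := @pi_ge2 R; have p0 : 0 < pi :> R := pi_gt0 R.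
have MB0 := mulr_ge0 (normr_ge0 M) b0; have MB1 := mulr_ge0 (normr_ge0 M) b1.
have hx : 1 + c + 2 * (`|M| * B0) + `|M| * B1 <= x by move: xr; rewrite /radius mulrA.
have x2 : 2^-1 <= x by lra.
have bC : `|M * cos_sum (eta_weight x) b| <= `|M| * B1.
  rewrite normrM ler_wpM2l//; apply: cos_sum_le => k; exact: eta_weight_le.
have bP : `|M * cos_sum (K0_weight x) b| * x <= `|M| * B0.
  rewrite normrM -mulrA ler_wpM2l// -ler_pdivlMr//.
  rewrite /B0 mulrAC; apply: cos_sum_le => k; exact: K0_weight_le.
have W34 : 3 / 4 <= potential m x b.
  rewrite /potential -/M mulrAC.
  set u := M * _ in bP *.
  have : `|u / pi| <= 1 / 4.
    rewrite normrM normfV (gtr0_norm p0) ler_pdivrMr//.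
    have : `|u| * x <= 2^-1 * x.
      move: hx MB0 MB1 bP c0; move: (`|M| * B0) (`|M| * B1) (`|u| * x) => y z w.
      by lra.
    by rewrite ler_pM2r//; lra.
  by rewrite ler_norml => /andP[? _]; lra.
have W0 : 0 < potential m x b by lra.
have C1 : `|2 / pi * (M * cos_sum (eta_weight x) b)| <= `|M| * B1.
  rewrite normrM; apply: le_trans bC; rewrite ler_piMl//.
  by rewrite ger0_norm ?divr_ge0 ?(ltW p0)// ler_pdivrMr// mul1r.
move: C1; rewrite ler_norml => /andP[C1 C2].
have px : 2 * x <= pi * x ^+ 2 by rewrite expr2; nra.
have f0 : 0 < f_polar m c x b by rewrite /f_polar -/M; lra.
split=> //; rewrite /gap /f_polar -/M.
have g1 : 0 <= shift m x b ^+ 2 / (pi * potential m x b).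
  by rewrite divr_ge0 ?sqr_ge0// mulr_ge0// ltW.
have g2 : pi * x ^+ 2 * (3 / 4) <= pi * x ^+ 2 * potential m x b.
  by rewrite ler_wpM2l// mulr_ge0 ?sqr_ge0// ltW.
have key (y t g yW N z : R) : 2 * x <= y -> - N <= t -> 0 <= g ->
    y * (3 / 4) <= yW -> 1 + c + 2 * z + N <= x -> 0 <= z -> 0 <= c ->
    2 * y - c - t - (4 * yW + g) < 0 by lra.
have := key _ _ _ _ _ _ px C1 g1 g2 hx MB0 c0.
by rewrite !(mulrA 2) !(mulrA 4).
Qed.

Lemma nondegenerate_far K : radius <= K -> nondegenerate_over Omega K.
Proof.
move=> Kr q qK u uT; have := uT u; rewrite (Tform_potential Om OmN) => /eqP.
have [W34 _ _] := instanton_bounds (cb q) (le_trans Kr (ltW qK)).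
rewrite mulf_eq0 gt_eqF/=; last by lra.
rewrite /gM /sqnorm_form zcE /= mulrN opprK -!expr2.
rewrite paddr_eq0 ?sqr_ge0// !sqrf_eq0 => /andP[/eqP -> /eqP ->].
by [].
Qed.

Lemma potential_heis x (b : R) (n : int) :
  potential m x (b + 2 * pi * n%:~R) = potential m x b.
Proof. by rewrite /potential cos_sum_periodic. Qed.

Lemma shift_heis x (b : R) (n : int) :
  shift m x (b + 2 * pi * n%:~R) = shift m x b.
Proof. by rewrite /shift sin_sum_periodic. Qed.

Lemma f_polar_heis x (b : R) (n : int) :
  f_polar m c x (b + 2 * pi * n%:~R) = f_polar m c x b.
Proof. by rewrite /f_polar cos_sum_periodic. Qed.

Lemma gap_heis x (b : R) (n : int) :
  gap m x (b + 2 * pi * n%:~R) = gap m x b.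
Proof. by rewrite /gap potential_heis shift_heis. Qed.

Lemma gNbar_far p : slice p -> radius <= cx (prN p) ->
  heis_invariant_at (gNbar Omega c) p /\
  inner_product_on (@slice_tangent R) (gNbar Omega c p).
Proof.
move=> sp xr; have [W34 f0 f10] := instanton_bounds (cb (prN p)) xr.
have W0 : 0 < potential m (cx (prN p)) (cb (prN p)) by lra.
have reg : regular m (cx (prN p)) by right; exact: le_trans radius_ge1 xr.
have gE u v : slice_tangent u -> slice_tangent v -> gNbar Omega c p u v =
    on_slice_qk (f_polar m c (cx (prN p)) (cb (prN p)))
      (f_polar m c (cx (prN p)) (cb (prN p)) - gap m (cx (prN p)) (cb (prN p)))
      (potential m (cx (prN p)) (cb (prN p))) (shift m (cx (prN p)) (cb (prN p)))
      p u v.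
  by move=> u0 v0; apply: (gNbar_slice Om OmN) => //; rewrite gt_eqF.
split.
  move=> d k u v u0 v0; rewrite !derive_heis gE// -(on_slice_qk_heis _ _ _ _ d k).
  have [hx _ _ hb] := heis_coord d k p.
  rewrite /on_slice_qk (gNbar_slice Om OmN) ?hx ?hb ?potential_heis ?shift_heis
    ?f_polar_heis ?gap_heis ?gt_eqF//.
  - exact: slice_heis.
  - by rewrite /slice_tangent /= prN_dheis.
  - by rewrite /slice_tangent /= prN_dheis.
apply: (inner_product_on_slice sp gE) => //.
by rewrite opprB addrC subrK.
Qed.

Lemma gFS_metric p : slice p -> 0 < rho c p ->
  heis_invariant_at (gFS c) p /\
  inner_product_on (@slice_tangent R) (gFS c p).
Proof.
move=> sp r0.
have gE u v : slice_tangent u -> slice_tangent v -> gFS c p u v =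
    on_slice_qk (rho c p) (- (rho c p + 2 * c)) 1 0 p u v.
  by move=> u0 v0; exact: gFS_slice.
split.
  move=> d k u v u0 v0; rewrite !derive_heis gE// -(on_slice_qk_heis _ _ _ _ d k).
  rewrite gFS_slice ?rho_heis//.
  - exact: slice_heis.
  - by rewrite /slice_tangent /= prN_dheis.
  - by rewrite /slice_tangent /= prN_dheis.
apply: (inner_product_on_slice sp gE) => //.
  by rewrite oppr_lt0 ltr_pwDl// mulr_ge0.
by rewrite rhoE//; move: (pi : R) => P; rewrite expr0n mul0r addr0; ring.
Qed.

Lemma Nbar_plusP (K : R) p : slice p -> K < cx (prN p) ->
  regular m (cx (prN p)) -> 0 < potential m (cx (prN p)) (cb (prN p)) ->
  0 < f_polar m c (cx (prN p)) (cb (prN p)) ->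
  f_polar m c (cx (prN p)) (cb (prN p)) - gap m (cx (prN p)) (cb (prN p)) < 0 ->
  Nbar_plus c Omega K (projP p).
Proof.
move=> sp Kx reg W0 f0 f10; have [x0 y0] := slice_coord sp.
have WN0 : potential m (cx (prN p)) (cb (prN p)) != 0 by rewrite gt_eqF.
have fE : f Omega c (prN p) = f_polar m c (cx (prN p)) (cb (prN p)).
  exact: (f_slice Om OmN).
have f1E := f1_slice Om OmN c y0 x0 reg WN0.
have gap0 : gap m (cx (prN p)) (cb (prN p)) != 0 by rewrite gt_eqF//; lra.
have nE : normc (zc (prN p)) = cx (prN p) by rewrite zcE y0 normc_slice// ltW.
exists p => //; split=> //; last 2 first.
- by rewrite fE.
- by rewrite f1E.
split; rewrite ?nE//.
- by rewrite fE gt_eqF.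
- by rewrite f1E lt_eqF.
suff -> : gN Omega (prN p) (Xfield (prN p)) (Xfield (prN p)) =
    gap m (cx (prN p)) (cb (prN p)) / pi.
  by rewrite mulf_neq0// invr_eq0 gt_eqF ?pi_gt0.
rewrite (gN_slice Om OmN)//; last exact: regular_parity.
rewrite /gibbons_hawking /gh_connection /gap; have [-> -> -> ->] := Xfield_coord y0.
have pN0 : pi != 0 :> R by rewrite gt_eqF ?pi_gt0.
have xN0 : cx (prN p) != 0 by rewrite gt_eqF.
move: (potential _ _ _) WN0 (pi : R) pN0 => W WN0 P pN0.
by field; rewrite ?pN0 ?xN0 ?WN0.
Qed.

Lemma end_nbhd_exists K : 0 < K ->
  exists U : set (heis_quot R),
    [/\ end_nbhd c U, U `<=` Nbar_plus c Omega K
      & forall p, slice p -> U (projP p) ->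
          [/\ heis_invariant_at (gFS c) p, heis_invariant_at (gNbar Omega c) p,
              inner_product_on (@slice_tangent R) (gFS c p)
            & inner_product_on (@slice_tangent R) (gNbar Omega c p)]].
Proof.
move=> K0; have r1 := radius_ge1; have p0 : 0 < pi :> R := pi_gt0 R.
pose rho0 : R := 2 * pi * (radius + K) ^+ 2.
have rho00 : 0 < rho0.
  have rK : 0 < radius + K by lra.
  by rewrite /rho0 mulr_gt0 ?exprn_gt0// mulr_gt0.
have far p : slice p -> rho0 < rho c p -> radius + K < cx (prN p).
  move=> sp; rewrite rhoE// /rho0 => h.
  have [x0 _] := sp; rewrite -/(cx _) in x0.
  rewrite -(@ltr_pXn2r _ 2)// ?nnegrE ?(ltW x0)//; last by lra.
  have pp : 0 < 2 * pi :> R by rewrite mulr_gt0.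
  rewrite -(ltr_pM2l pp); apply: lt_le_trans h _.
  by rewrite lerBlDr lerDl.
exists (rho_above c rho0); split.
- split; last by exists rho0.
  by move=> _ [p [sp rp _] <-]; exists p.
- move=> _ [p [sp rp r0p] <-]; have xf := far _ sp r0p.
  have xr : radius <= cx (prN p) by lra.
  have [W34 f0 f10] := instanton_bounds (cb (prN p)) xr.
  apply: Nbar_plusP => //; [by lra| |by lra].
  by right; lra.
- move=> p sp [p' [sp' rp' r0p']] /projP_eq [d [k pE]].
  have rp : rho0 < rho c p by rewrite pE rho_heis.
  have xr : radius <= cx (prN p) by have := far _ sp rp; lra.
  have [? ?] := gNbar_far sp xr.
  have [? ?] := gFS_metric sp (lt_trans rho00 rp).
  by split.
Qed.

End NearInfinity.

(** * The construction without instantons *)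

Section NoInstantons.
Variables (R : realType) (c : R).
Hypothesis c0 : 0 <= c.
Implicit Types (p u v : 'rV[R]_(4 + 1)) (x b : R).

Lemma potential0 x b : potential 0 x b = 1.
Proof. by rewrite /potential mulr0z !mul0r addr0. Qed.

Lemma shift0 x b : shift 0 x b = 0.
Proof. by rewrite /shift mulr0z mulr0 mul0r. Qed.

Lemma regular0 x : regular 0 x.
Proof. by left. Qed.

Lemma f_polar0 p : slice p ->
  f_polar 0 c (cx (prN p)) (cb (prN p)) = rho c p.
Proof. by move=> sp; rewrite rhoE// /f_polar mulr0z mul0r mulr0 subr0. Qed.

Lemma f_polar_gap0 p : slice p ->
  f_polar 0 c (cx (prN p)) (cb (prN p)) - gap 0 (cx (prN p)) (cb (prN p)) =
  - (rho c p + 2 * c).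
Proof.
move=> sp; rewrite f_polar0// /gap potential0 shift0 rhoE//.
by move: (pi : R) => P; rewrite expr0n mul0r; ring.
Qed.

Lemma gNbar0 p u v : slice p -> 0 < rho c p ->
  slice_tangent u -> slice_tangent v ->
  gNbar (fun=> 0) c p u v = gFS c p u v.
Proof.
move=> sp r0 u0 v0; rewrite gFS_slice// (gNbar_slice (m := 0))//.
- by rewrite f_polar_gap0// f_polar0// potential0 shift0.
- exact: regular0.
- by rewrite potential0 oner_eq0.
Qed.

Lemma Nbar_plus0 : Nbar_plus c (fun=> 0) 0 = N_UH c.
Proof.
apply/seteqP; split=> y [p]; last first.
  move=> [sp r0] <-; have [x0 y0] := slice_coord sp.
  apply: (Nbar_plusP (m := 0)) => //.
  - exact: regular0.
  - by rewrite potential0.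
  - by rewrite f_polar0.
  - by rewrite f_polar_gap0// oppr_lt0 ltr_pwDl// mulr_ge0.
move=> [sp _ f0 _] <-; exists p => //; split=> //.
have [x0 y0] := slice_coord sp.
by rewrite -f_polar0// -(f_slice (Omega := fun=> 0) (m := 0)).
Qed.

End NoInstantons.

(** * Volumes of the two ends *)

Section Volume.
Variables (R : realType) (c : R).
Hypothesis c0 : 0 <= c.
Implicit Types (x a b s : R).

Definition rad_rho x : R := 2 * pi * x ^+ 2 - c.
Definition vol_density x : R := 2 * x * (rad_rho x + 2 * c) / rad_rho x ^+ 4.

Lemma slice_pt_coord x a b s :
  [/\ cx (prN (slice_pt x a b s)) = x, cy (prN (slice_pt x a b s)) = 0,
      ca (prN (slice_pt x a b s)) = a & cb (prN (slice_pt x a b s)) = b].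
Proof. by rewrite /cx /cy /ca /cb /prN /slice_pt !mxE. Qed.

Lemma slice_slice_pt x a b s : 0 < x -> slice (slice_pt x a b s).
Proof.
move=> x0; have [hx hy _ _] := slice_pt_coord x a b s.
by split; [rewrite -[complex.Re _]/(cx _) hx|exact: hy].
Qed.

Lemma rho_slice_pt x a b s : 0 < x -> rho c (slice_pt x a b s) = rad_rho x.
Proof.
move=> x0; rewrite rhoE; last exact: slice_slice_pt.
by have [-> _ _ _] := slice_pt_coord x a b s.
Qed.

Definition frame (i : 'I_4) : 'rV[R]_(4 + 1) :=
  delta_mx 0 (lift (@Ordinal 5 1 isT) i).

Lemma frame_tangent i : slice_tangent (frame i).
Proof.
by rewrite /slice_tangent /= /prN /frame !mxE; move: i; apply: ord4P.
Qed.

Lemma frame_coord i :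
  [/\ cx (prN (frame i)) = (i == 0%N :> nat)%:R,
      ca (prN (frame i)) = (i == 1%N :> nat)%:R,
      cb (prN (frame i)) = (i == 2%N :> nat)%:R
    & sigma (frame i) = (i == 3%N :> nat)%:R].
Proof.
by rewrite /cx /ca /cb /sigma /prN /frame; split; rewrite !mxE; move: i; apply: ord4P.
Qed.

(** The Gram matrix is E D E^T with D diagonal and E unitriangular, E being
    the matrix of the coframe in which the metric is diagonal. *)
Lemma det_gramFS x a b s : 0 < x -> 0 < rad_rho x ->
  \det (gramFS c (slice_pt x a b s)) = vol_density x ^+ 2.
Proof.
move=> x0 r0; set p := slice_pt x a b s.
have sp : slice p by exact: slice_slice_pt.
have rp : rho c p = rad_rho x by exact: rho_slice_pt.
have xp : cx (prN p) = x by have [] := slice_pt_coord x a b s.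
pose E : 'M[R]_4 := \matrix_(i, k) nth 0 [:: cx (prN (frame i)); ca (prN (frame i));
  cb (prN (frame i)); dsigma_theta p (frame i)] k.
pose r := rad_rho x.
pose d0 := (r + 2 * c) / (4 * (r + c) * r ^+ 2) * (4 * pi * x) ^+ 2.
pose d1 := - ((2 * pi * r)^-1 * (1 - 2 * (r + c) / r)).
pose d3 := 4 * (r + c) / (r ^+ 2 * (r + 2 * c)).
pose d : 'rV[R]_4 := \row_k nth 0 [:: d0; d1; d1; d3] k.
have gramE : gramFS c p = E *m diag_mx d *m E^T.
  apply/matrixP => i j; rewrite mxE -/(frame i) -/(frame j).
  rewrite mul_mx_diag mxE sum4 !mxE /= /gFS !derive_rho//; try exact: frame_tangent.
  rewrite rp xp -/r /sqnorm_form /W0 !theta_dx !theta_dy /= /d0 /d1 /d3.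
  ring.
have detE : \det E = 1.
  rewrite -det_tr det_trig; last first.
    apply/is_trig_mxP => i j ij; rewrite !mxE /dsigma_theta !theta_dx !theta_dy.
    have [-> -> -> ->] := frame_coord j.
    move: i j ij; do 2 apply: ord4P => //=.
  apply: big1 => i _; rewrite !mxE /dsigma_theta !theta_dx !theta_dy.
  have [-> -> -> ->] := frame_coord i.
  by move: i; apply: ord4P => /=; ring.
rewrite gramE !det_mulmx det_tr detE mul1r mulr1 det_diag.
rewrite !big_ord_recl big_ord0 !mxE /= /vol_density -/r /d0 /d1 /d3.
have rE : c = 2 * pi * x ^+ 2 - r by rewrite /r /rad_rho; ring.
have r2 : r + 2 * c != 0 by rewrite gt_eqF// ltr_pwDl// mulr_ge0.
have r3 : r + c != 0 by rewrite gt_eqF// ltr_pwDl.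
have rN0 : r != 0 by rewrite gt_eqF.
have xN0 : x != 0 by rewrite gt_eqF.
have pN0 : pi != 0 :> R by rewrite gt_eqF ?pi_gt0.
clear gramE d d0 d1 d3; clearbody r; move: r2 r3; rewrite rE => r2 r3.
move: (pi : R) pN0 r2 r3 {rE} => P pN0 r2 r3.
by field; rewrite ?rN0 ?r2 ?r3 ?xN0 ?pN0.
Qed.

Lemma integral_period (L k : R) : 0 < L ->
  (\int[lebesgue_measure]_(t in period L) k%:E)%E = (k * L)%:E.
Proof.
move=> L0; have mL : measurable (period L) by exact: measurable_itv.
have := integral_cst lebesgue_measure mL k%:E; rewrite /cst => ->.
rewrite [X in (_ * X)%E](_ : _ = L%:E) ?EFinM//.
apply: (etrans (lebesgue_measure_itv `[0, L[)).
by rewrite /= lte_fin L0 oppr0 adde0.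
Qed.

Lemma half_lineP x : half_line x <-> 0 < x.
Proof. by rewrite /half_line /= in_itv /= andbT. Qed.

Lemma volFS_radial (A : set (heis_quot R)) (I : set R) :
  measurable I -> I `<=` @half_line R ->
  (forall x a b s, 0 < x -> A (projP (slice_pt x a b s)) <-> I x) ->
  (forall x, I x -> 0 < rad_rho x) ->
  volFS c A =
  (\int[lebesgue_measure]_(x in I) (vol_density x * (4 * pi ^+ 3))%:E)%E.
Proof.
move=> mI Ih AI Irho; have p0 : 0 < pi :> R := pi_gt0 R.
rewrite /volFS -[in RHS](setIidr Ih) integral_mkcondr.
apply: eq_integral => x; rewrite inE => /half_lineP x0.
pose g : R := if x \in I then vol_density x else 0.
have gE a b s : \1_A (projP (slice_pt x a b s)) *
    Num.sqrt (\det (gramFS c (slice_pt x a b s))) = g.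
  rewrite /g indicE; have [Ix|nIx] := boolP (x \in I).
    have {}Ix : I x by rewrite inE in Ix.
    rewrite mem_set; last by apply/AI.
    rewrite mul1r det_gramFS ?Irho// sqrtr_sqr ger0_norm//.
    have r0 := Irho _ Ix; rewrite /vol_density divr_ge0 ?exprn_ge0 ?(ltW r0)//.
    by rewrite !mulr_ge0 ?(ltW x0)// addr_ge0 ?(ltW r0)// mulr_ge0.
  rewrite memNset ?mul0r// => /AI -/(_ x0) Ix.
  by move: nIx; rewrite notin_setE.
transitivity ((g * pi * (2 * pi) * (2 * pi))%:E).
  rewrite -integral_period ?mulr_gt0//; apply: eq_integral => a _.
  rewrite -integral_period ?mulr_gt0//; apply: eq_integral => b _.
  rewrite -integral_period//; apply: eq_integral => s _.
  by rewrite gE.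
rewrite patchE /g; case: ifP => _; congr (_%:E); ring.
Qed.

Lemma projP_slice_set (P : R -> Prop) x a b s : 0 < x ->
  ((@projP R @` [set p | [/\ slice p, 0 < rho c p & P (rho c p)]])
    (projP (slice_pt x a b s))) <-> 0 < rad_rho x /\ P (rad_rho x).
Proof.
move=> x0; rewrite -(rho_slice_pt a b s x0); split.
  by move=> [p [sp r0 Pr] /projP_eq [d [k ->]]]; rewrite rho_heis.
by move=> [r0 Pr]; exists (slice_pt x a b s) => //; split => //; exact: slice_slice_pt.
Qed.

Definition level_radius y : R := Num.sqrt ((y + c) / (2 * pi)).

Lemma level_radius_sqr y : 0 <= y -> 2 * pi * level_radius y ^+ 2 = y + c.
Proof.
move=> y0; have p0 : 0 < pi :> R := pi_gt0 R.
have pp : 0 < 2 * pi :> R by rewrite mulr_gt0.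
rewrite sqr_sqrtr ?divr_ge0 ?addr_ge0 ?(ltW pp)//.
by rewrite mulrC divfK// gt_eqF.
Qed.

Lemma level_radius_ge0 y : 0 <= level_radius y.
Proof. exact: sqrtr_ge0. Qed.

Lemma lt_level_radius x y : 0 <= x -> 0 <= y -> (level_radius y < x) = (y < rad_rho x).
Proof.
move=> x0 y0; have pp : 0 < 2 * pi :> R by rewrite mulr_gt0 ?pi_gt0.
rewrite -(@ltr_pXn2r _ 2)// ?nnegrE ?level_radius_ge0// -(ltr_pM2l pp).
by rewrite level_radius_sqr// /rad_rho ltrBrDr.
Qed.

Lemma gt_level_radius x y : 0 <= x -> 0 <= y -> (x < level_radius y) = (rad_rho x < y).
Proof.
move=> x0 y0; have pp : 0 < 2 * pi :> R by rewrite mulr_gt0 ?pi_gt0.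
rewrite -(@ltr_pXn2r _ 2)// ?nnegrE ?level_radius_ge0// -(ltr_pM2l pp).
by rewrite level_radius_sqr// /rad_rho ltrBlDr.
Qed.

Lemma vol_density_ge0 x : 0 <= x -> 0 < rad_rho x -> 0 <= vol_density x.
Proof.
move=> x0 r0; rewrite /vol_density divr_ge0 ?exprn_ge0 ?(ltW r0)//.
by rewrite !mulr_ge0// addr_ge0 ?(ltW r0)// mulr_ge0.
Qed.

Lemma measurable_vol_density (I : set R) : open I ->
  (forall x, I x -> 0 < rad_rho x) ->
  measurable_fun I (fun x => vol_density x * (4 * pi ^+ 3)).
Proof.
move=> oI Irho; apply: open_continuous_measurable_fun => // x; rewrite inE => Ix.
have r0 := Irho _ Ix.
have cr : {for x, continuous rad_rho}.
  apply: cvgB; last exact: cvg_cst.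
  by apply: cvgM; [exact: cvg_cst|exact: exprn_continuous].
apply: cvgM; last exact: cvg_cst.
apply: cvgM.
  apply: cvgM; first by apply: cvgM; [exact: cvg_cst|exact: cvg_id].
  by apply: cvgD; [exact: cr|exact: cvg_cst].
apply: cvgV; first by rewrite expf_neq0// gt_eqF.
by apply: (@continuous_comp _ _ _ rad_rho (fun y => y ^+ 4));
  [exact: cr|exact: exprn_continuous].
Qed.

(** Where rho > rho0, rho is at least a multiple of x^2, hence the density is
    O(x^-5); the bound by 1 / (1 + x^2) has a known integral. *)
Lemma vol_density_le rho0 : 0 < rho0 -> exists2 C : R, 0 <= C &
  forall x, level_radius rho0 < x ->
    vol_density x * (4 * pi ^+ 3) <= C * (oneDsqr x)^-1.
Proof.
move=> rho00; have p0 : 0 < pi :> R := pi_gt0 R.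
pose x1 := level_radius rho0; pose k := rho0 / (rho0 + c).
have rc0 : 0 < rho0 + c by rewrite ltr_pwDl.
have x10 : 0 < x1 by rewrite sqrtr_gt0 divr_gt0 ?mulr_gt0.
have k0 : 0 < k by rewrite divr_gt0.
pose c1 := 8 * pi / (k * (2 * pi)) ^+ 4 * (4 * pi ^+ 3).
have c10 : 0 <= c1 by rewrite /c1 !(mulr_ge0, invr_ge0, exprn_ge0, ltW p0, ltW k0).
exists (c1 * (x1 ^- 5 + x1 ^- 3)).
  by rewrite mulr_ge0// addr_ge0 ?invr_ge0 ?exprn_ge0 ?(ltW x10).
move=> x xx1; have x0 : 0 < x by exact: lt_trans xx1.
have r0 : rho0 < rad_rho x by rewrite -lt_level_radius ?(ltW x0) ?(ltW rho00).
set r := rad_rho x in r0 *; have r_gt0 : 0 < r by exact: lt_trans r0.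
have rE : 2 * pi * x ^+ 2 = r + c by rewrite /r /rad_rho subrK.
have kr : k * (2 * pi * x ^+ 2) <= r.
  rewrite rE /k mulrAC ler_pdivrMr//.
  have : rho0 * c <= r * c by rewrite ler_wpM2r// ltW.
  by lra.
have y0 : 0 < k * (2 * pi * x ^+ 2).
  by apply: mulr_gt0 => //; apply: mulr_gt0; [exact: mulr_gt0|exact: exprn_gt0].
apply: (@le_trans _ _ (c1 * x ^- 5)).
  have -> : c1 * x ^- 5 =
      2 * x * (2 * (2 * pi * x ^+ 2)) / (k * (2 * pi * x ^+ 2)) ^+ 4 * (4 * pi ^+ 3).
    rewrite /c1; move: (pi : R) p0 => P p0.
    by field; rewrite !gt_eqF.
  rewrite ler_wpM2r ?mulr_ge0 ?exprn_ge0 ?(ltW p0)//.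
  rewrite /vol_density -/r; apply: ler_pM.
  - by rewrite !mulr_ge0 ?(ltW x0)// addr_ge0 ?(ltW r_gt0)// mulr_ge0.
  - by rewrite invr_ge0 exprn_ge0// ltW.
  - by rewrite ler_wpM2l ?mulr_ge0 ?(ltW x0)// rE; lra.
  - rewrite lef_pV2 ?posrE ?exprn_gt0// lerXn2r ?nnegrE ?(ltW y0)//.
    exact: ltW.
rewrite ler_pdivlMr ?oneDsqr_gt0// -mulrA ler_wpM2l//.
have -> : x ^- 5 * oneDsqr x = x ^- 5 + x ^- 3.
  by rewrite /oneDsqr; field; rewrite gt_eqF.
by apply: lerD; rewrite lef_pV2 ?posrE ?exprn_gt0// lerXn2r ?nnegrE ?(ltW x0)
  ?(ltW x10) ?(ltW xx1).
Qed.

Lemma volFS_above rho0 : 0 < rho0 -> (volFS c (rho_above c rho0) < +oo)%E.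
Proof.
move=> rho00; pose I : set R := `]level_radius rho0, +oo[%classic.
have IP x : I x <-> level_radius rho0 < x by rewrite /I /= in_itv /= andbT.
have I0 x : I x -> 0 < x.
  by move=> /IP; apply: le_lt_trans; exact: level_radius_ge0.
have Irho x : I x -> 0 < rad_rho x.
  move=> Ix; apply: (lt_trans rho00).
  rewrite -(lt_level_radius (ltW (I0 _ Ix)) (ltW rho00)).
  exact: (IP x).1 Ix.
have mI : measurable I by exact: measurable_itv.
have volE : volFS c (rho_above c rho0) =
    (\int[lebesgue_measure]_(x in I) (vol_density x * (4 * pi ^+ 3))%:E)%E.
  apply: (volFS_radial mI); last exact: Irho.
    by move=> x Ix; apply/half_lineP; exact: I0.
  move=> x a b s x0; rewrite /rho_above (projP_slice_set (fun y => rho0 < y))//.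
  rewrite IP lt_level_radius ?(ltW x0) ?(ltW rho00)//.
  by split=> [[]//|h]; split=> //; exact: lt_trans h.
rewrite volE.
have [C C0 volC] := vol_density_le rho00.
have mD : measurable_fun setT (fun x : R => (oneDsqr x)^-1).
  by apply: continuous_measurable_fun => x; exact: continuous_oneDsqrV.
apply: (@le_lt_trans _ _ (\int[lebesgue_measure]_(x in I)
    (C%:E * ((oneDsqr x)^-1)%:E))%E).
  apply: ge0_le_integral => //.
  - move=> x Ix; rewrite lee_fin; apply: mulr_ge0.
      by apply: vol_density_ge0; [exact: ltW (I0 _ Ix)|exact: Irho].
    by rewrite mulr_ge0 ?exprn_ge0 ?pi_ge0.
  - apply/measurable_EFinP; apply: measurable_vol_density => //.
  - apply: emeasurable_funM; first exact: measurable_cst.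
    by apply/measurable_EFinP; apply: measurable_funTS.
  - by move=> x /IP Ix; rewrite -EFinM lee_fin volC.
have mID : measurable_fun I (fun x : R => ((oneDsqr x)^-1)%:E).
  by apply/measurable_EFinP; exact: measurable_funTS mD.
have D0 x : (0 <= ((oneDsqr x)^-1)%:E)%E.
  by rewrite lee_fin invr_ge0 ltW ?oneDsqr_gt0.
have -> : (\int[lebesgue_measure]_(x in I) (C%:E * ((oneDsqr x)^-1)%:E) =
    C%:E * \int[lebesgue_measure]_(x in I) ((oneDsqr x)^-1)%:E)%E.
  by apply: ge0_integralZl_EFin.
rewrite lte_mul_pinfty ?lee_fin//.
apply: (@le_lt_trans _ _ (\int[lebesgue_measure]_(x in `[0%R, +oo[)
    ((oneDsqr x)^-1)%:E)%E); last by rewrite integral0y_oneDsqr ltry.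
apply: ge0_subset_integral => //.
  by apply/measurable_EFinP; exact: measurable_funTS mD.
by move=> x /I0 x0; rewrite /= in_itv /= andbT ltW.
Qed.

(** The part {e <= rho <= 2 e} of the inner end already has volume of order
    e ^- 2, the density being at least 2 x / rho ^ 3. *)
Lemma volFS_below rho0 : 0 < rho0 -> volFS c (rho_below c rho0) = +oo%E.
Proof.
move=> rho00; pose I : set R := `]level_radius 0, level_radius rho0[%classic.
have p0 : 0 < pi :> R := pi_gt0 R.
have IP x : I x <-> level_radius 0 < x /\ x < level_radius rho0.
  by rewrite /I /= in_itv /=; split=> /andP.
have I0 x : I x -> 0 < x.
  by move=> /IP [+ _]; apply: le_lt_trans; exact: level_radius_ge0.
have Irho x : I x -> 0 < rad_rho x.
  by move=> Ix; rewrite -lt_level_radius ?(ltW (I0 _ Ix))//; have /IP[] := Ix.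
have mI : measurable I by exact: measurable_itv.
have -> : volFS c (rho_below c rho0) =
    (\int[lebesgue_measure]_(x in I) (vol_density x * (4 * pi ^+ 3))%:E)%E.
  apply: (volFS_radial mI); last exact: Irho.
    by move=> x Ix; apply/half_lineP; exact: I0.
  move=> x a b s x0; rewrite /rho_below (projP_slice_set (fun y => y < rho0))//.
  by rewrite IP lt_level_radius ?(ltW x0)// gt_level_radius ?(ltW x0) ?(ltW rho00).
have mf : measurable_fun I (fun x => (vol_density x * (4 * pi ^+ 3))%:E).
  apply/measurable_EFinP; apply: measurable_vol_density => //.
have f0 x : I x -> (0 <= (vol_density x * (4 * pi ^+ 3))%:E)%E.
  move=> Ix; rewrite lee_fin; apply: mulr_ge0.
    by apply: vol_density_ge0; [exact: ltW (I0 _ Ix)|exact: Irho].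
  by rewrite mulr_ge0 ?exprn_ge0 ?pi_ge0.
apply/eqyP => A A0.
(* The lower bound obtained below is (2 / 3) e^-2; e <= 1 and e <= 1 / (2 A)
   make it exceed A, and e <= rho0 / 4 keeps rho = 2 e below rho0. *)
pose e := Num.min 1 (Num.min (rho0 / 4) (2 * A)^-1).
have e0 : 0 < e by rewrite /e !lt_min ltr01 divr_gt0// invr_gt0 mulr_gt0.
have [e1 [er eA]] : e <= 1 /\ e <= rho0 / 4 /\ e <= (2 * A)^-1.
  by rewrite /e; split; [|split]; rewrite !ge_min lexx ?orbT.
pose xa := level_radius e; pose xb := level_radius (2 * e).
have e20 : 0 < 2 * e by rewrite mulr_gt0.
have xaE : 2 * pi * xa ^+ 2 = e + c by rewrite level_radius_sqr// ltW.
have xbE : 2 * pi * xb ^+ 2 = 2 * e + c by rewrite level_radius_sqr// ltW.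
have xa0 : 0 < xa by rewrite sqrtr_gt0 divr_gt0 ?mulr_gt0// ltr_pwDl.
have xb0 : 0 <= xb by exact: level_radius_ge0.
have xab : xa < xb by rewrite lt_level_radius ?(ltW e0)// /rad_rho xbE; lra.
pose J : set R := `[xa, xb]%classic.
have JP x : J x <-> xa <= x /\ x <= xb by rewrite /J /= in_itv /=; split=> /andP.
have mJ : measurable J by exact: measurable_itv.
have JI : J `<=` I.
  move=> x /JP [xax xxb]; apply/IP; split.
    apply: lt_le_trans xax; rewrite lt_level_radius ?(ltW xa0)// /rad_rho xaE.
    by rewrite addrK.
  apply: le_lt_trans xxb _; rewrite gt_level_radius ?(ltW rho00)// /rad_rho xbE.
  by rewrite addrK; lra.
pose m0 := 2 * xa / (8 * e ^+ 3) * (4 * pi ^+ 3).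
have volJ x : J x -> m0 <= vol_density x * (4 * pi ^+ 3).
  move=> Jx; have r0 := Irho _ (JI _ Jx); have [xax xxb] := (JP x).1 Jx.
  have x0 : 0 < x by exact: lt_le_trans xax.
  rewrite /m0 ler_wpM2r ?mulr_ge0 ?exprn_ge0 ?(ltW p0)//.
  have r2 : rad_rho x <= 2 * e.
    by rewrite leNgt -lt_level_radius ?(ltW x0) ?(ltW e20)// -leNgt.
  apply: (@le_trans _ _ (2 * x / rad_rho x ^+ 3)).
    apply: ler_pM; rewrite ?mulr_ge0 ?invr_ge0 ?mulr_ge0 ?exprn_ge0 ?(ltW xa0)
      ?(ltW e0)//.
      by rewrite ler_pM2l.
    rewrite lef_pV2 ?posrE ?exprn_gt0 ?mulr_gt0 ?exprn_gt0//.
    rewrite (_ : 8 * e ^+ 3 = (2 * e) ^+ 3); last by ring.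
    by rewrite lerXn2r ?nnegrE ?(ltW r0) ?(ltW e20).
  rewrite (_ : 2 * x / _ = 2 * x * rad_rho x / rad_rho x ^+ 4); last first.
    by field; rewrite gt_eqF.
  rewrite /vol_density ler_wpM2r ?invr_ge0 ?exprn_ge0 ?(ltW r0)//.
  by rewrite ler_wpM2l ?mulr_ge0 ?(ltW x0)// lerDl mulr_ge0.
apply: (@le_trans _ _ (\int[lebesgue_measure]_(x in J)
    (vol_density x * (4 * pi ^+ 3))%:E)%E); last exact: ge0_subset_integral.
have m00 : 0 <= m0.
  by rewrite /m0 !mulr_ge0 ?invr_ge0 ?mulr_ge0 ?exprn_ge0 ?(ltW xa0) ?(ltW e0)
    ?(ltW p0).
apply: (@le_trans _ _ (\int[lebesgue_measure]_(x in J) (cst m0%:E) x)%E); last first.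
  apply: ge0_le_integral => //.
  by apply: measurable_funS mf.
rewrite integral_cst//.
rewrite [X in (_ <= _ * X)%E](_ : _ = (xb - xa)%:E); last first.
  by apply: (etrans (lebesgue_measure_itv `[xa, xb])); rewrite /= lte_fin xab.
rewrite -EFinM lee_fin.
have diff : e <= 2 * pi * (3 * xa) * (xb - xa).
  have xb2 : xb <= 2 * xa.
    rewrite -(@ler_pXn2r _ 2)// ?nnegrE// ?mulr_ge0 ?(ltW xa0)//.
    have pp : 0 < 2 * pi :> R by rewrite mulr_gt0.
    have key (u : R) : 0 < u -> 2 * u + c <= 2 ^+ 2 * (u + c).
      by move: c0 => hc hu; lra.
    by rewrite -(ler_pM2l pp) xbE exprMn mulrCA xaE key.
  have -> : e = 2 * pi * (xb + xa) * (xb - xa).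
    rewrite (_ : _ * _ = 2 * pi * xb ^+ 2 - 2 * pi * xa ^+ 2); last by ring.
    by rewrite xbE xaE; ring.
  rewrite ler_wpM2r ?subr_ge0 ?(ltW xab)// ler_wpM2l ?mulr_ge0 ?(ltW p0)//.
  by lra.
have -> : m0 * (xb - xa) = pi ^+ 2 / (6 * e ^+ 3) * (2 * pi * (3 * xa) * (xb - xa)).
  rewrite /m0; move: (pi : R) => P.
  by field; rewrite gt_eqF.
apply: (@le_trans _ _ (pi ^+ 2 / (6 * e ^+ 3) * e)); last first.
  by rewrite ler_wpM2l// divr_ge0 ?mulr_ge0 ?exprn_ge0 ?(ltW p0) ?(ltW e0).
apply: (@le_trans _ _ (2 / 3 / e)); last first.
  have pi2 : 4 <= pi ^+ 2 :> R by have := @pi_ge2 R; rewrite expr2; nra.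
  rewrite (_ : 2 / 3 / e = 4 / (6 * e)); last by field; rewrite gt_eqF.
  rewrite (_ : pi ^+ 2 / _ * e = pi ^+ 2 / (6 * e) / e); last by field; rewrite gt_eqF.
  rewrite -[leLHS]mulr1; apply: ler_pM => //.
  - by rewrite divr_ge0// mulr_ge0// ltW.
  - by rewrite ler_wpM2r// invr_ge0 mulr_ge0// ltW.
  - by rewrite invf_ge1.
rewrite ler_pdivlMr//.
have : A * e <= A * (2 * A)^-1 by rewrite ler_pM2l.
rewrite invfM mulrCA divff ?gt_eqF//; lra.
Qed.

End Volume.

(** * The deformation near the end of finite volume *)

Theorem corollary5p11 (R : realType) (c : R) (hc : 0 <= c)
    (m : int) (hm : m != 0) (Omega : Lambda -> int)
    (hsupp : forall g : Lambda,
        (Omega g != 0) = (g \in [:: gamma_dy; - gamma_dy]))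
    (hOmega : Omega gamma_dy = m) (hOmegaN : Omega (- gamma_dy) = m) :
  [/\ exists2 K0 : R, 0 < K0 &
        forall K, K0 <= K -> nondegenerate_over Omega K,
      forall rho0 : R, 0 < rho0 ->
        (volFS c (rho_above c rho0) < +oo)%E /\
        volFS c (rho_below c rho0) = +oo%E,
      forall K : R, 0 < K -> nondegenerate_over Omega K ->
        exists U : set (heis_quot R),
          [/\ end_nbhd c U,
              U `<=` Nbar_plus c Omega K
            & forall p, slice p -> U (projP p) ->
                [/\ heis_invariant_at (gFS c) p,
                    heis_invariant_at (gNbar Omega c) p,
                    inner_product_on (@slice_tangent R) (gFS c p)
                  & inner_product_on (@slice_tangent R) (gNbar Omega c p)]]
    & Nbar_plus c (fun=> 0) 0 = N_UH c /\
      forall p u v, slice p -> 0 < rho c p ->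
        slice_tangent u -> slice_tangent v ->
        gNbar (fun=> 0) c p u v = gFS c p u v].
Proof.
split.
- exists (radius m c); first exact: lt_le_trans (radius_ge1 m hc).
  by move=> K; exact: nondegenerate_far hOmega hOmegaN hc K.
- by move=> rho0 rho00; split; [exact: volFS_above|exact: volFS_below].
- move=> K K0 _; have [U UP] := end_nbhd_exists hOmega hOmegaN hc K0.
  by exists U.
- split; first exact: Nbar_plus0.
  by move=> p u v sp r0 u0 v0; exact: gNbar0.
Qed.
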